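(* Let $R$ be a semilocal commutative ring with $2\in R^\times$. Let $(A,\sigma)$ be either a quadratic étale $R$-algebra with its standard involution, in which case put $\mathrm{Tr}=\mathrm{Tr}_{A/R}$, or a quaternion Azumaya $R$-algebra with its unique symplectic involution, in which case put $\mathrm{Tr}=\mathrm{Trd}_{A/R}$ (the reduced trace). Let $(P,f)$ and $(P',f')$ be unimodular $1$-hermitian spaces over $(A,\sigma)$. Then: (i) $(P,f)$ is isotropic if and only if the unimodular $1$-hermitian space $(P,\mathrm{Tr}\circ f)$ over $(R,\mathrm{id}_R)$ is isotropic. (ii) $(P,f)\cong(P',f')$ if and only if $(P,\mathrm{Tr}\circ f)\cong(P',\mathrm{Tr}\circ f')$ as $1$-hermitian spaces over $(R,\mathrm{id}_R)$.
   Context: Conventions. Rings are commutative and unital, and $2$ is invertible in all rings and algebras. A quadratic étale $R$-algebra is a finite étale commutative $R$-algebra of constant rank $2$; its standard involution is $x\mapsto\mathrm{Tr}_{A/R}(x)-x$. A quaternion Azumaya $R$-algebra is an Azumaya $R$-algebra of degree $2$; its unique symplectic involution is $x\mapsto\mathrm{Trd}_{A/R}(x)-x$. A unimodular $1$-hermitian space over an algebra with involution $(A,\sigma)$ is a pair $(P,f)$ with $P$ a finitely generated projective right $A$-module and $f:P\times P\to A$ biadditive with $f(xa,yb)=a^\sigma f(x,y)b$, $f(x,y)=f(y,x)^\sigma$ and $x\mapsto f(x,-):P\to\mathrm{Hom}_A(P,A)$ bijective. An isometry $(P,f)\to(P',f')$ is an $A$-module isomorphism $\varphi$ with $f'(\varphi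 x,\varphi y)=f(x,y)$; $\cong$ denotes existence of an isometry. $(P,f)$ is isotropic if $P$ has a nonzero $A$-module direct summand $M$ with $f(M,M)=0$. (Over $(R,\mathrm{id}_R)$ summands are $R$-module summands.) *)

(* Defs.v *)
From HB Require Import structures.
From mathcomp Require Import all_boot all_order all_algebra.
From mathcomp Require Import boolp.

Set Implicit Arguments.
Unset Strict Implicit.
Unset Printing Implicit Defensive.

Import GRing.Theory.
Local Open Scope ring_scope.
Local Open Scope quotient_scope.

(* Right modules over a ring A are left modules over the converse ring A^c:   *)
(* for x : P and a : A, the right action x a is written a *: x.               *)
(* Subsets are boolean predicates; with the classical axioms of boolp these   *)
(* are all the subsets.                                                       *)

Section Ideals.
Variable R : comPzRingType.
Implicit Types I J p : {pred R}.

Definition ideal_closed I := submod_closed (I : {pred R^o}).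

Definition prime_ideal p :=
  [/\ ideal_closed p, 1 \notin p
    & forall x y : R, x * y \in p -> (x \in p) || (y \in p)].

Definition maximal_ideal I :=
  [/\ ideal_closed I, 1 \notin I
    & forall J, ideal_closed J -> 1 \notin J -> {subset I <= J} -> J =i I].

Definition semilocal :=
  exists s : seq {pred R},
    forall I, maximal_ideal I -> exists2 k, (k < size s)%N & I =i nth xpred0 s k.

End Ideals.

(* P is a direct summand of a free module of finite rank. *)
Definition fg_projective (R : pzRingType) (P : lmodType R) :=
  exists n (i : {linear P -> 'rV[R]_n}) (p : {linear 'rV[R]_n -> P}),
    cancel i p.

Definition faithful_module (R : pzRingType) (P : lmodType R) :=
  forall r : R, (forall x : P, r *: x = 0) -> r = 0.

(* The localization of P at the prime p is free with basis e_i / 1. Since     *)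
(* denominators are units, every finite basis of the localization can be      *)
(* rescaled to one of this form.                                              *)
Definition local_basis (R : comPzRingType) (P : lmodType R) (p : {pred R})
    n (e : 'I_n -> P) :=
  (forall x : P, exists2 s : R, s \notin p &
     exists c : 'I_n -> R, s *: x = \sum_i c i *: e i) /\
  (forall c : 'I_n -> R,
     (exists2 s : R, s \notin p & s *: (\sum_i c i *: e i) = 0) ->
     forall i, exists2 s : R, s \notin p & s * c i = 0).

Definition constant_rank (R : comPzRingType) (P : lmodType R) n :=
  forall p : {pred R}, prime_ideal p ->
    exists e : 'I_n -> P, local_basis p e.

(* Trace of an endomorphism u of a finitely generated projective module: the  *)
(* trace of the matrix of u extended by zero to a free module containing P as *)
(* a direct summand (the value does not depend on the summand presentation).  *)
Definition is_trace (R : comPzRingType) (P : lmodType R) (u : P -> P) (t : R) :=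
  exists n (i : {linear P -> 'rV[R]_n}) (p : {linear 'rV[R]_n -> P}),
    cancel i p /\ t = \tr (lin1_mx (i \o u \o p)).

(* Tensor product over R: formal sums of pairs, two of them being identified  *)
(* when every R-balanced biadditive map to an abelian group takes the same    *)
(* value on both.                                                             *)

Section Tensor.
Variables (R : comPzRingType) (M N : lmodType R).

Record balanced (V : zmodType) (b : M -> N -> V) : Prop := Balanced {
  balancedDl : forall x x' y, b (x + x') y = b x y + b x' y;
  balancedDr : forall x y y', b x (y + y') = b x y + b x y';
  balancedZ : forall r x y, b (r *: x) y = b x (r *: y) }.

Definition feval (V : zmodType) (b : M -> N -> V) (s : seq (M * N)) : V :=
  \sum_(p <- s) b p.1 p.2.

Definition tens_rel (s t : seq (M * N)) : bool :=
  `[< forall (V : zmodType) (b : M -> N -> V), balanced b ->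
        feval b s = feval b t >].

Lemma tens_relP s t :
  reflect (forall (V : zmodType) (b : M -> N -> V), balanced b ->
             feval b s = feval b t) (tens_rel s t).
Proof. exact: asboolP. Qed.

Lemma tens_rel_refl : reflexive tens_rel.
Proof. by move=> s; apply/tens_relP. Qed.

Lemma tens_rel_sym : symmetric tens_rel.
Proof.
by move=> s t; apply/tens_relP/tens_relP => H V b /H.
Qed.

Lemma tens_rel_trans : transitive tens_rel.
Proof.
move=> t s u /tens_relP st /tens_relP tu.
by apply/tens_relP => V b bb; rewrite st ?tu.
Qed.

Canonical tens_equiv :=
  EquivRel tens_rel tens_rel_refl tens_rel_sym tens_rel_trans.

Definition tens : Type := {eq_quot tens_equiv}.

HB.instance Definition _ := Choice.on tens.
HB.instance Definition _ := EqQuotient.on tens.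

Definition tens_lift (V : zmodType) (b : M -> N -> V) (t : tens) : V :=
  feval b (repr t).

Definition tens_mk (x : M) (y : N) : tens := \pi_tens [:: (x, y)].

Lemma tens_lift_pi (V : zmodType) (b : M -> N -> V) s :
  balanced b -> tens_lift b (\pi_tens s) = feval b s.
Proof.
move=> bb; have /eqP : \pi_tens (repr (\pi_tens s)) = \pi_tens s :> tens.
  by rewrite reprK.
by rewrite eqmodE => /tens_relP; apply.
Qed.

Lemma tens_eqP (t u : tens) :
  (forall (V : zmodType) (b : M -> N -> V), balanced b ->
     tens_lift b t = tens_lift b u) <-> t = u.
Proof.
split=> [tu | -> //]; rewrite -[t]reprK -[u]reprK.
by apply/eqP; rewrite eqmodE; apply/tens_relP.
Qed.

Definition tens_zero : tens := \pi_tens [::].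
Definition tens_add (t u : tens) : tens := \pi_tens (repr t ++ repr u).
Definition tens_opp (t : tens) : tens :=
  \pi_tens [seq (- p.1, p.2) | p <- repr t].
Definition tens_scale (r : R) (t : tens) : tens :=
  \pi_tens [seq (r *: p.1, p.2) | p <- repr t].

Section Eval.
Variables (V : zmodType) (b : M -> N -> V).
Hypothesis bb : balanced b.

Let bNl x y : b (- x) y = - b x y.
Proof.
have b0 : b 0 y = 0.
  by apply: (addrI (b 0 y)); rewrite -(balancedDl bb) !addr0.
by apply/eqP; rewrite -addr_eq0 -(balancedDl bb) addNr b0.
Qed.

Lemma tens_lift_zero : tens_lift b tens_zero = 0.
Proof. by rewrite tens_lift_pi // /feval big_nil. Qed.

Lemma tens_lift_add t u :
  tens_lift b (tens_add t u) = tens_lift b t + tens_lift b u.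
Proof. by rewrite tens_lift_pi // /feval big_cat. Qed.

Lemma tens_lift_opp t : tens_lift b (tens_opp t) = - tens_lift b t.
Proof.
rewrite tens_lift_pi // /tens_lift /feval big_map -sumrN.
by apply: eq_bigr => p _; rewrite bNl.
Qed.

Lemma tens_lift_mk x y : tens_lift b (tens_mk x y) = b x y.
Proof. by rewrite tens_lift_pi // /feval big_seq1. Qed.

Lemma balanced_scale r : balanced (fun x y => b (r *: x) y).
Proof.
split=> [x x' y|x y y'|s x y].
- by rewrite scalerDr (balancedDl bb).
- by rewrite (balancedDr bb).
- by rewrite scalerA mulrC -scalerA (balancedZ bb).
Qed.

Lemma tens_lift_scale r t :
  tens_lift b (tens_scale r t) = tens_lift (fun x y => b (r *: x) y) t.
Proof. by rewrite tens_lift_pi // /tens_lift /feval big_map. Qed.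

End Eval.

Fact tens_addA : associative tens_add.
Proof.
by move=> t u v; apply/tens_eqP => V b bb; rewrite !tens_lift_add // addrA.
Qed.

Fact tens_addC : commutative tens_add.
Proof.
by move=> t u; apply/tens_eqP => V b bb; rewrite !tens_lift_add // addrC.
Qed.

Fact tens_add0 : left_id tens_zero tens_add.
Proof.
move=> t; apply/tens_eqP => V b bb.
by rewrite tens_lift_add // tens_lift_zero // add0r.
Qed.

Fact tens_addN : left_inverse tens_zero tens_opp tens_add.
Proof.
move=> t; apply/tens_eqP => V b bb.
by rewrite tens_lift_add // tens_lift_opp // tens_lift_zero // addNr.
Qed.

HB.instance Definition _ :=
  GRing.isZmodule.Build tens tens_addA tens_addC tens_add0 tens_addN.

Fact tens_scaleA r s t : tens_scale r (tens_scale s t) = tens_scale (r * s) t.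
Proof.
apply/tens_eqP => V b bb.
have br := balanced_scale bb r.
rewrite tens_lift_scale // tens_lift_scale // tens_lift_scale //.
by apply: eq_bigr => p _; rewrite scalerA.
Qed.

Fact tens_scale1 : left_id 1 tens_scale.
Proof.
move=> t; apply/tens_eqP => V b bb; rewrite tens_lift_scale //.
by apply: eq_bigr => p _; rewrite scale1r.
Qed.

Fact tens_scaleDr : right_distributive tens_scale +%R.
Proof.
move=> r t u; apply/tens_eqP => V b bb; have br := balanced_scale bb r.
by rewrite tens_lift_scale // !tens_lift_add // !tens_lift_scale.
Qed.

Fact tens_scaleDl t : {morph tens_scale^~ t : r s / r + s}.
Proof.
move=> r s; apply/tens_eqP => V b bb.
rewrite tens_lift_add // !tens_lift_scale // /tens_lift /feval -big_split.
by apply: eq_bigr => p _; rewrite scalerDl (balancedDl bb).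
Qed.

HB.instance Definition _ :=
  GRing.Zmodule_isLmodule.Build R tens
    tens_scaleA tens_scale1 tens_scaleDr tens_scaleDl.

Lemma balanced_mk : balanced tens_mk.
Proof.
split=> [x x' y|x y y'|r x y]; apply/tens_eqP => V b bb.
- by rewrite tens_lift_add // !tens_lift_mk // (balancedDl bb).
- by rewrite tens_lift_add // !tens_lift_mk // (balancedDr bb).
- by rewrite !tens_lift_mk // (balancedZ bb).
Qed.

End Tensor.

Definition tens_map (R : comPzRingType) (M N M' N' : lmodType R)
    (g : M -> M') (h : N -> N') (t : tens M N) : tens M' N' :=
  tens_lift (fun x y => tens_mk (g x) (h y)) t.

Section Algebras.
Variables (R : comPzRingType) (A : algType R).

(* The multiplication map A (x) A -> A splits as a map of A-bimodules. *)
Definition separable_algebra :=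
  exists s : A -> tens A A,
    [/\ {morph s : x y / x + y},
        forall a b x : A,
          s (a * x * b) = tens_map (fun y => a * y) (fun z => z * b) (s x)
      & forall x : A, tens_lift (fun y z : A => y * z) (s x) = x].

(* A finite algebra is etale iff it is projective and separable. *)
Definition finite_etale :=
  [/\ commutative (@GRing.mul A), fg_projective A & separable_algebra].

Definition quadratic_etale := finite_etale /\ constant_rank A 2.

(* The image of a tensor under A (x) A^op -> End_R(A),                        *)
(* a (x) b |-> (x |-> a x b), evaluated at x.                                 *)
Definition sandwich (t : tens A A) (x : A) : A :=
  tens_lift (fun a b => a * x * b) t.

Definition azumaya :=
  [/\ fg_projective A, faithful_module A,
      forall t u : tens A A, sandwich t =1 sandwich u -> t = u
    & forall g : {linear A -> A}, exists t : tens A A, sandwich t =1 g].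

Definition azumaya_of_degree n := azumaya /\ constant_rank A (n ^ 2)%N.

Definition faithfully_flat :=
  (forall (M N : lmodType R) (g : {linear M -> N}),
     injective g -> injective (tens_map (N := A) g id)) /\
  (forall M : lmodType R,
     (forall t : tens M A, t = 0) -> forall x : M, x = 0).

End Algebras.

Section Traces.
Variables (R : comPzRingType) (A : algType R).

Definition is_regular_trace (Tr : A -> R) :=
  forall a : A, is_trace (fun x : A => a * x) (Tr a).

(* alpha is an R-algebra map inducing an isomorphism A (x) S -> M_n(S). *)
Definition splitting (S : algType R) n (alpha : {rmorphism A -> 'M[S]_n}) :=
  (forall r : R, alpha r%:A = (r%:A)%:M) /\
  bijective (tens_lift (fun (a : A) (s : S) => s *: alpha a)).

(* The reduced trace is the matrix trace after a faithfully flat splitting;   *)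
(* it takes values in R and does not depend on the splitting.                 *)
Definition is_reduced_trace n (Trd : A -> R) :=
  exists (S : algType R) (alpha : {rmorphism A -> 'M[S]_n}),
    [/\ commutative (@GRing.mul S), faithfully_flat S, splitting alpha
      & forall a : A, (Trd a)%:A = \tr (alpha a)].

End Traces.

Section Hermitian.
Variables (A : pzRingType) (sigma : A -> A).

(* (A^c)^o is A as a right module over itself, so the last two fields say     *)
(* that x |-> f(x, -) is a bijection from P to Hom_A(P, A).                   *)
Record unimodular_hermitian (P : lmodType A^c) (f : P -> P -> A) : Prop :=
  UnimodularHermitian {
    herm_fgproj : fg_projective P;
    hermDl : forall x x' y, f (x + x') y = f x y + f x' y;
    hermDr : forall x y y', f x (y + y') = f x y + f x y';
    hermZ : forall (a b : A) x y,
      f ((a : A^c) *: x) ((b : A^c) *: y) = sigma a * f x y * b;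
    herm_sym : forall x y, f x y = sigma (f y x);
    herm_inj : forall x x', f x =1 f x' -> x = x';
    herm_surj : forall g : {linear P -> (A^c)^o}, exists x, f x =1 g }.

Definition isotropic (P : lmodType A^c) (f : P -> P -> A) :=
  exists M N : {pred P},
    [/\ submod_closed M, submod_closed N,
        (forall x, exists y z, [/\ y \in M, z \in N & x = y + z]) /\
        (forall x, x \in M -> x \in N -> x = 0),
        exists2 x, x \in M & x != 0
      & forall x y, x \in M -> y \in M -> f x y = 0].

Definition isometric (P P' : lmodType A^c)
    (f : P -> P -> A) (f' : P' -> P' -> A) :=
  exists phi : {linear P -> P'},
    bijective phi /\ forall x y, f' (phi x) (phi y) = f x y.

End Hermitian.

(* Restriction of scalars from A to R. *)
Section Restriction.
Variables (R : comPzRingType) (A : algType R) (P : lmodType A^c).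

Definition restr : Type := P.

HB.instance Definition _ := GRing.Zmodule.on restr.

Definition restr_scale (r : R^c) (x : restr) : restr :=
  (((r : R)%:A : A) : A^c) *: (x : P).

Fact restr_scaleA r s x : restr_scale r (restr_scale s x) = restr_scale (r * s) x.
Proof.
rewrite /restr_scale scalerA; congr (_ *: _).
by rewrite /GRing.mul /= -scalerAl mul1r scalerA.
Qed.

Fact restr_scale1 : left_id 1 restr_scale.
Proof. by move=> x; rewrite /restr_scale scale1r [LHS]scale1r. Qed.

Fact restr_scaleDr : right_distributive restr_scale +%R.
Proof. by move=> r x y; rewrite /restr_scale [LHS]scalerDr. Qed.

Fact restr_scaleDl x : {morph restr_scale^~ x : r s / r + s}.
Proof. by move=> r s; rewrite /restr_scale scalerDl [LHS]scalerDl. Qed.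

HB.instance Definition _ :=
  GRing.Zmodule_isLmodule.Build R^c restr
    restr_scaleA restr_scale1 restr_scaleDr restr_scaleDl.

Lemma restr_scaleE (r : R) (x : restr) :
  (r : R^c) *: x = (((r%:A : A) : A^c) *: (x : P) : P).
Proof. by []. Qed.

Definition transfer (Tr : A -> R) (f : P -> P -> A) : restr -> restr -> R :=
  fun x y => Tr (f x y).

End Restriction.

(* Main.v *)
Require Import Defs.
From HB Require Import structures.
From mathcomp Require Import all_boot all_order all_algebra.
From mathcomp Require Import boolp classical_sets.
From mathcomp Require Import ring.

(* In both cases the standard involution is a |-> Tr a - a, the norm          *)
(* N a = a^sigma a lies in R, and the trace form of A is regular; only this   *)
(* is used. In particular f(x, x) is half of Tr f(x, x).                      *)
(*                                                                            *)
(* (ii) As R is semilocal, the Chinese remainder theorem yields x in P with   *)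
(* f(x, x) invertible wherever P is nonzero, so P = xA + P_1 orthogonally. An *)
(* R-isometry psi gives x' = psi x with f'(x', x') = f(x, x). The R-modules   *)
(* xA and x'A have the same Gram matrix, so Witt cancellation over R, that    *)
(* is, transitivity of reflections on vectors of equal value, provides an     *)
(* R-isometry between the orthogonal complements; conclude by induction on    *)
(* the rank.                                                                  *)
(*                                                                            *)
(* (i) From an isotropic R-summand one gets v with f(v, v) = 0 and w with     *)
(* Tr f(v, w) = 1 (on the support of the summand). Where P has rank 1,        *)
(* f(v, w) has trace 1 and norm 0, so it is idempotent. Where the rank is at  *)
(* least 2, a suitable reflection of v is an isotropic x such that f(x, y) is *)
(* invertible for some y: the reflecting vector is chosen at each maximal     *)
(* ideal separately. In both cases some f(x, y) is a nonzero idempotent and   *)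
(* x generates, after projection, an isotropic summand.                       *)

(** Both kinds of algebra are treated through the record [quadratic_trace], obtained in
    [quadratic_etale_trace] and [reduced_trace_quadratic]. It makes [invol] an anti-automorphism
    whose fixed elements are scalars, so [f x x] is the scalar [qf x] and the trace form on x A is
    [qf x] times the trace form of A ([trf_act]). Hence x and x' of equal value span R-isometric
    subspaces x A and x' A.

    R may have idempotents, so ranks are not constant and values are invertible only on a part of R.
    An element d with [d * d * b x x = d] plays the inverse of [b x x]; then [d * b x x] is the
    idempotent of the part where x is anisotropic. Vectors are chosen modulo each maximal ideal and
    glued by [semilocal_select]; [nakayama] turns pointwise invertibility into an identity on the
    whole subspace.

    For isometries, [reg_anisotropic] gives x whose value is invertible on the support of S. Witt
    cancellation ([reg_transitive], applied along an orthogonal basis of A in [isometry_trf_perp])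
    yields an R-isometry of the hermitian complements of x and its image. By induction that isometry
    may be replaced by an A-linear one, and [herm_isometry_extend] adds x A back ([isometry_herm]).

    For isotropy, [isotropic_summand] extracts v with [b v v = 0] and w with [b v w] a nonzero
    idempotent. The difficulty is that [f v w] itself may be a zero divisor of A.
    [exists_nondegenerate] repairs this in rank at least 2 by reflecting v, while in rank 1 [f v w]
    is already idempotent; [isotropic_of_idempotent] turns the outcome into a summand. The other
    directions are immediate. *)

Set Implicit Arguments.
Unset Strict Implicit.
Unset Printing Implicit Defensive.

Import GRing.Theory.
Local Open Scope ring_scope.

(** * Linear identities *)

(* The square-zero extension R + E, a commutative ring in which the tactic    *)
(* ring proves the R-linear identities of E.                                  *)
Section SquareZero.
Variables (R : comPzRingType) (E : lmodType R).

Definition sqz : Type := (R * E)%type.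

HB.instance Definition _ := GRing.Zmodule.on sqz.

Definition sqz_mul (u v : sqz) : sqz := (u.1 * v.1, u.1 *: v.2 + v.1 *: u.2).

Fact sqz_mulA : associative sqz_mul.
Proof.
move=> u v w; rewrite /sqz_mul /= mulrA; congr pair.
rewrite !scalerDr !scalerA addrA; congr (_ + _ + _).
  by rewrite [w.1 * _]mulrC.
by rewrite [v.1 * _]mulrC.
Qed.

Fact sqz_mulC : commutative sqz_mul.
Proof. by move=> u v; rewrite /sqz_mul mulrC addrC. Qed.

Fact sqz_mul1 : left_id (1, 0) sqz_mul.
Proof. by move=> [r x]; rewrite /sqz_mul /= mul1r scale1r scaler0 addr0. Qed.

Fact sqz_mulD : left_distributive sqz_mul +%R.
Proof.
move=> u v w; rewrite /sqz_mul /= mulrDl; congr pair.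
by rewrite scalerDl scalerDr addrACA.
Qed.

HB.instance Definition _ := GRing.Zmodule_isComPzRing.Build sqz
  sqz_mulA sqz_mulC sqz_mul1 sqz_mulD.

Definition sqz_scalar (r : R) : sqz := (r, 0).
Definition sqz_vector (x : E) : sqz := (0, x).

Fact sqz_scalar_zmod : zmod_morphism sqz_scalar.
Proof. by move=> r s; congr pair; rewrite /= subr0. Qed.

Fact sqz_scalar_monoid : monoid_morphism sqz_scalar.
Proof.
by split=> // r s; congr pair; rewrite /= !scaler0 addr0.
Qed.

HB.instance Definition _ :=
  GRing.isZmodMorphism.Build R sqz sqz_scalar sqz_scalar_zmod.
HB.instance Definition _ :=
  GRing.isMonoidMorphism.Build R sqz sqz_scalar sqz_scalar_monoid.

Fact sqz_vector_zmod : zmod_morphism sqz_vector.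
Proof. by move=> x y; congr pair; rewrite /= subr0. Qed.

HB.instance Definition _ :=
  GRing.isZmodMorphism.Build E sqz sqz_vector sqz_vector_zmod.

Lemma sqz_vectorZ r x : sqz_vector (r *: x) = sqz_scalar r * sqz_vector x.
Proof. by congr pair; rewrite /= ?mulr0 // scale0r addr0. Qed.

Lemma sqz_vectorD x y : sqz_vector (x + y) = sqz_vector x + sqz_vector y.
Proof. exact: raddfD. Qed.

Lemma sqz_vectorN x : sqz_vector (- x) = - sqz_vector x.
Proof. exact: raddfN. Qed.

Lemma sqz_vector_inj : injective sqz_vector.
Proof. by move=> x y []. Qed.

Definition sqzE := (sqz_vectorD, sqz_vectorN, sqz_vectorZ).

End SquareZero.

Ltac module_ring := apply: sqz_vector_inj; rewrite ?sqzE; ring.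

(** * Maximal ideals of a semilocal ring *)

Section MaximalIdeals.
Variable R : comPzRingType.
Implicit Types (I J m : {pred R}) (x y r : R).

Lemma ideal0 I : ideal_closed I -> 0 \in I. Proof. by case. Qed.

Lemma idealD I x y : ideal_closed I -> x \in I -> y \in I -> x + y \in I.
Proof. by case=> _ h xI yI; have := h 1 _ _ xI yI; rewrite scale1r. Qed.

Lemma ideal_mull I x y : ideal_closed I -> y \in I -> x * y \in I.
Proof. by case=> I0 h yI; have := h x _ _ yI I0; rewrite addr0. Qed.

Lemma ideal_mulr I x y : ideal_closed I -> x \in I -> x * y \in I.
Proof. by move=> hI xI; rewrite mulrC ideal_mull. Qed.

Lemma idealN I x : ideal_closed I -> x \in I -> - x \in I.
Proof. by move=> hI xI; rewrite -mulN1r ideal_mull. Qed.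

Lemma idealB I x y : ideal_closed I -> x \in I -> y \in I -> x - y \in I.
Proof. by move=> hI xI yI; rewrite idealD ?idealN. Qed.

Lemma idealDr I x y : ideal_closed I -> x \in I -> (x + y \in I) = (y \in I).
Proof.
move=> hI xI; apply/idP/idP => [h|]; last exact: idealD.
by have := idealB hI h xI; rewrite addrAC subrr add0r.
Qed.

Lemma idealDl I x y : ideal_closed I -> y \in I -> (x + y \in I) = (x \in I).
Proof. by rewrite addrC; exact: idealDr. Qed.

Lemma ideal_closedP (P : R -> Prop) :
  P 0 -> (forall r x y, P x -> P y -> P (r * x + y)) ->
  ideal_closed (fun x => `[< P x >]).
Proof.
move=> P0 h; split; first exact/asboolP.
by move=> r x y /asboolP Px /asboolP Py; apply/asboolP/h.
Qed.

Lemma exists_maximal_ideal I : ideal_closed I -> 1 \notin I ->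
  exists2 m, maximal_ideal m & {subset I <= m}.
Proof.
move=> hI I1.
pose P J := [/\ ideal_closed J, 1 \notin J & {subset I <= J}].
pose T := {J : R -> bool | P J}.
pose le (s t : T) := `[< {subset sval s <= sval t} >].
have I0 : T by exists I; split.
have [t tmax] : exists t : T, forall s, le t s -> s = t.
  apply: (@Zorn T le) => [t|r s t /asboolP rs /asboolP st|[s hs] [t ht] /asboolP st /asboolP ts|F tot].
  - exact/asboolP.
  - by apply/asboolP => x /rs /st.
  - apply: eq_exist; apply/funext => x; apply/idP/idP => h; first exact: (st x).
    exact: (ts x).
  - have [[s0 Fs0]|nF] := pselect (exists s, F s); last first.
      by exists I0 => s Fs; case: nF; exists s.
    pose U x := exists2 s, F s & x \in sval s.
    have PU : P (fun x => `[< U x >]).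
      have Uin s x : F s -> x \in sval s -> U x by move=> *; exists s.
      split.
      - apply: ideal_closedP.
          by apply: (Uin s0) => //; have [/ideal0] := svalP s0.
        move=> r x y [s Fs xs] [t Ft yt].
        have [/asboolP st|/asboolP ts] := tot _ _ Fs Ft.
          apply: (Uin t) => //; have [ht _ _] := svalP t.
          by apply: idealD => //; apply: ideal_mull => //; apply: st.
        apply: (Uin s) => //; have [hs _ _] := svalP s.
        by apply: idealD => //; [apply: ideal_mull|apply: ts].
      - by apply/negP => /asboolP [s Fs]; apply/negP; have [] := svalP s.
      - by move=> x xI; apply/asboolP; exists s0 => //; have [_ _] := svalP s0; apply.
    by exists (exist _ _ PU) => s Fs; apply/asboolP => x xs; apply/asboolP; exists s.
case: t tmax => t [ht t1 It] tmax; exists t => //; split => // J hJ J1 tJ.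
have PJ : P J by split => // x /It /tJ.
have /(congr1 sval) /= -> // : exist _ _ PJ = exist _ t (And3 ht t1 It).
by apply: tmax; apply/asboolP.
Qed.

Lemma maximal_ideal_inv m x : maximal_ideal m -> x \notin m ->
  exists y, 1 - x * y \in m.
Proof.
move=> [hm m1 mmax] xm; apply: contrapT => nex.
pose J : {pred R} := fun z => `[< exists2 u, u \in m & exists y, z = u + x * y >].
have hJ : ideal_closed J.
  apply: ideal_closedP; first by exists 0; [exact: ideal0|exists 0; rewrite mulr0 addr0].
  move=> r _ _ [u um [y ->]] [v vm [z ->]]; exists (r * u + v).
    by rewrite idealD // ideal_mull.
  by exists (r * y + z); ring.
have J1 : 1 \notin J.
  apply/negP => /asboolP [u um [y e]]; apply: nex; exists y.
  by rewrite e addrK.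
have mJ : {subset m <= J}.
  by move=> u um; apply/asboolP; exists u => //; exists 0; rewrite mulr0 addr0.
move/negP: xm; apply; rewrite -(mmax J hJ J1 mJ); apply/asboolP.
by exists 0; [exact: ideal0|exists 1; rewrite add0r mulr1].
Qed.

Lemma maximal_idealM m x y : maximal_ideal m ->
  (x * y \in m) = (x \in m) || (y \in m).
Proof.
move=> mm; have [hm m1 _] := mm.
apply/idP/orP => [xym|[xm|ym]]; [|exact: ideal_mulr|exact: ideal_mull].
have [|xm] := boolP (x \in m); first by left.
right; have [z /(ideal_mulr y hm) h] := maximal_ideal_inv mm xm.
have -> : y = (1 - x * z) * y + z * (x * y) by ring.
by rewrite idealD // ideal_mull.
Qed.

Lemma maximal_prime m : maximal_ideal m -> prime_ideal m.
Proof.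
by move=> mm; have [hm m1 _] := mm; split => // x y; rewrite maximal_idealM.
Qed.

(** A maximal ideal containing u and 1 - e would contain e as well, so u and 1 - e generate R. The
    element v is the inverse of u in the factor R e, extended by zero. *)
Lemma unit_on_idempotent (e u : R) : e * e = e ->
  (forall m, maximal_ideal m -> e \notin m -> u \notin m) ->
  exists v, [/\ v * u = e, v * e = v & v * v * u = v].
Proof.
move=> ee h.
pose J : {pred R} := fun z => `[< exists a b, z = a * u + b * (1 - e) >].
have hJ : ideal_closed J.
  apply: ideal_closedP; first by exists 0, 0; ring.
  by move=> r _ _ [a [b ->]] [a' [b' ->]]; exists (r * a + a'), (r * b + b'); ring.
have [/asboolP [a [b e1]]|nJ] := boolP (1 \in J).
  have aue : a * e * u = e.
    have -> : a * e * u = (a * u + b * (1 - e)) * e by ring: ee.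
    by rewrite -e1 mul1r.
  exists (a * e); split=> //; first by ring: ee.
  by rewrite -mulrA aue -mulrA ee.
have [m mm Jm] := exists_maximal_ideal hJ nJ.
have [hm m1 _] := mm.
have um : u \in m by apply: Jm; apply/asboolP; exists 1, 0; ring.
have em : 1 - e \in m by apply: Jm; apply/asboolP; exists 0, 1; ring.
case/negP: (contraL (h m mm) um) => /=.
apply/negP => em'; case/negP: m1.
by have -> : 1 = (1 - e) + e by [ring]; apply: idealD.
Qed.

Lemma local_zero (E : lmodType R) (x : E) :
  (forall m, maximal_ideal m -> exists2 s, s \notin m & s *: x = 0) -> x = 0.
Proof.
move=> h; pose J : {pred R} := fun s => `[< s *: x = 0 >].
have hJ : ideal_closed J.
  apply: ideal_closedP; first by rewrite scale0r.
  by move=> r s t sx tx; rewrite scalerDl -scalerA sx tx scaler0 addr0.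
have [/asboolP|nJ] := boolP (1 \in J); first by rewrite scale1r.
have [m mm Jm] := exists_maximal_ideal hJ nJ.
have [s /negP sm sx] := h m mm; case: sm; apply: Jm; exact/asboolP.
Qed.

Hypothesis R_semilocal : semilocal R.

Lemma semilocal_seq : exists s : seq {pred R},
  forall m, maximal_ideal m -> exists2 k, (k < size s)%N & nth xpred0 s k = m.
Proof.
have [s hs] := R_semilocal; exists s => m /hs [k ks mk]; exists k => //.
by apply/funext => x; have := mk x; rewrite !unfold_in.
Qed.

(* The Chinese remainder theorem, in the form of a simultaneous choice of     *)
(* residues inside a submodule S.                                             *)
Lemma semilocal_select (E : lmodType R) (S : E -> Prop)
    (Q : {pred R} -> E -> Prop) :
  S 0 -> (forall r (x y : E), S x -> S y -> S (r *: x + y)) ->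
  (forall m (x z : E) r, maximal_ideal m -> S x -> S z -> r \in m ->
     Q m x -> Q m (r *: z + x)) ->
  (forall m, maximal_ideal m -> exists2 x, S x & Q m x) ->
  exists2 x, S x & forall m, maximal_ideal m -> Q m x.
Proof.
move=> S0 Slin Qmod ex; have [s hs] := semilocal_seq.
suff [x Sx hx] : exists2 x, S x & forall k, (k < size s)%N ->
    maximal_ideal (nth xpred0 s k) -> Q (nth xpred0 s k) x.
  by exists x => // m mm; have [k ks mk] := hs m mm; rewrite -mk; apply: hx; rewrite ?mk.
elim: s {hs} => [|m s [x Sx hx]]; first by exists 0.
have [mm|nmm] := pselect (maximal_ideal m); last first.
  by exists x => // -[_ /nmm//|k ks]; apply: hx.
have [[k ks mk]|nex] := pselect (exists2 k, (k < size s)%N & nth xpred0 s k = m).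
  by exists x => // -[_ _|j js]; [rewrite /= -mk; apply: hx; rewrite ?mk|apply: hx].
have [x0 Sx0 Qx0] := ex m mm.
have [hm m1 mmax] := mm.
have [t tm ts] : exists2 t, t \notin m & forall k, (k < size s)%N ->
    maximal_ideal (nth xpred0 s k) -> t \in nth xpred0 s k.
  elim: s {hx} nex => [|p s IH] nex; first by exists 1.
  have [|t tm ts] := IH.
    by move=> [k ks e]; apply: nex; exists k.+1.
  have [pp|npp] := pselect (maximal_ideal p); last first.
    by exists t => // -[_ /npp//|k ks]; apply: ts.
  have [u up um] : exists2 u, u \in p & u \notin m.
    apply: contrapT => nu; apply: nex; exists 0%N => //=.
    have [hp p1 pmax] := pp.
    have pm : {subset p <= m}.
      by move=> u up; apply/negPn/negP => um; apply: nu; exists u.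
    by apply/funext => u; have := pmax m hm m1 pm u; rewrite !unfold_in.
  exists (t * u); first by rewrite maximal_idealM // negb_or tm.
  move=> [_ _|k ks kk] /=; first by case: pp => hp _ _; exact: ideal_mull.
  by have [hk _ _] := kk; apply: ideal_mulr => //; exact: ts.
have [r rm] := maximal_ideal_inv mm tm.
(* As t * r is 1 modulo m and 0 modulo the other listed maximal ideals, this vector is congruent to
   x0 at m and to x elsewhere. *)
have e1 : (t * r) *: (x0 - x) + x = (1 - t * r) *: (x - x0) + x0.
  rewrite scalerBr scalerBl scale1r scalerBr opprB.
  by rewrite [RHS]addrAC subrK [RHS]addrC.
have SB (y z : E) : S y -> S z -> S (y - z).
  by move=> Sy Sz; rewrite addrC -scaleN1r; apply: Slin.
exists ((t * r) *: (x0 - x) + x); first by apply: Slin => //; exact: SB.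
move=> [_ _|k ks kk] /=; first by rewrite e1; apply: Qmod => //; exact: SB.
apply: Qmod => //; [exact: SB| |exact: hx].
by have [hk _ _] := kk; apply: ideal_mulr => //; exact: ts.
Qed.

End MaximalIdeals.

(** * Regular quadratic modules *)

Lemma det_congr (R : comPzRingType) (m : {pred R}) n (A B : 'M[R]_n) :
  ideal_closed m -> (forall i j, A i j - B i j \in m) -> \det A - \det B \in m.
Proof.
move=> hm AB; rewrite /determinant -sumrB.
apply: (big_ind (fun x => x \in m)) => [|x y|s _]; first exact: ideal0.
  exact: idealD.
rewrite -mulrBr ideal_mull //.
apply: (big_ind2 (fun x y : R => x - y \in m)) => [|x x' y y' xx yy|i _]; last exact: AB.
    by rewrite subrr; exact: ideal0.
have -> : x * y - x' * y' = x * (y - y') + (x - x') * y' by ring.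
exact: (idealD hm (ideal_mull x hm yy) (ideal_mulr y' hm xx)).
Qed.

Section Bilinear.
Variables (R : comPzRingType) (E : lmodType R) (b : E -> E -> R).

Record symmetric_bilinear : Prop := SymmetricBilinear {
  sbC : forall x y, b x y = b y x;
  sbP : forall r x y z, b (r *: x + y) z = r * b x z + b y z }.

Hypothesis hb : symmetric_bilinear.

Lemma sbDl x y z : b (x + y) z = b x z + b y z.
Proof. by rewrite -{1}[x]scale1r sbP // mul1r. Qed.

Lemma sb0l z : b 0 z = 0.
Proof. by apply: (addrI (b 0 z)); rewrite -sbDl !addr0. Qed.

Lemma sbZl r x z : b (r *: x) z = r * b x z.
Proof. by rewrite -[r *: x]addr0 sbP // sb0l addr0. Qed.

Lemma sbNl x z : b (- x) z = - b x z.
Proof. by rewrite -scaleN1r sbZl mulN1r. Qed.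

Lemma sbBl x y z : b (x - y) z = b x z - b y z.
Proof. by rewrite sbDl sbNl. Qed.

Lemma sbDr x y z : b z (x + y) = b z x + b z y.
Proof. by rewrite !(sbC hb z) sbDl. Qed.

Lemma sb0r z : b z 0 = 0.
Proof. by rewrite sbC // sb0l. Qed.

Lemma sbZr r x z : b z (r *: x) = r * b z x.
Proof. by rewrite !(sbC hb z) sbZl. Qed.

Lemma sbNr x z : b z (- x) = - b z x.
Proof. by rewrite !(sbC hb z) sbNl. Qed.

Lemma sbBr x y z : b z (x - y) = b z x - b z y.
Proof. by rewrite sbDr sbNr. Qed.

Definition sbE := (sbDl, sbZl, sbNl, sb0l, sbDr, sbZr, sbNr, sb0r).

Lemma sb_sumr (I : finType) (F : I -> E) z :
  b z (\sum_i F i) = \sum_i b z (F i).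
Proof.
by apply: (big_morph (b z)) => [x y|]; rewrite ?sbDr ?sb0r.
Qed.

(** A dual basis whose coordinate functionals are represented by b. With z and y inside S it encodes
    at once that S is finitely generated projective and that b is unimodular on S. *)
Definition dual_frame (S : E -> Prop) (I : finType) (z y : I -> E) :=
  forall s, S s -> s = \sum_i b (y i) s *: z i.

Lemma dual_frame_ord (S : E -> Prop) (I : finType) (z y : I -> E) :
  dual_frame S z y ->
  dual_frame S (z \o @enum_val I xpredT) (y \o @enum_val I xpredT).
Proof.
move=> zy s /zy {1}->; rewrite (reindex (@enum_val I xpredT)) //=.
exact/onW_bij/enum_val_bij.
Qed.

(* Cayley-Hamilton for the Gram matrix of a dual frame. *)
Lemma dual_frame_det (S : E -> Prop) n (z y : 'I_n -> E) :
  dual_frame S z y -> forall s, S s ->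
  \det (1%:M - \matrix_(i, j) b (y i) (z j)) *: s = 0.
Proof.
move=> zy s Ss; set G := \matrix_(i, j) _.
pose c := \col_i b (y i) s.
have Gc : (1%:M - G) *m c = 0.
  apply/colP => i; rewrite mulmxBl mul1mx !mxE {1}(zy s Ss) sb_sumr.
  apply/eqP; rewrite subr_eq0; apply/eqP/eq_bigr => j _.
  by rewrite !mxE sbZr mulrC.
have dc : \det (1%:M - G) *: c = 0.
  by rewrite -mul_scalar_mx -mul_adj_mx -mulmxA Gc mulmx0.
rewrite (zy s Ss) scaler_sumr big1 // => i _.
by have /colP/(_ i) := dc; rewrite scalerA !mxE => ->; rewrite scale0r.
Qed.

(** Let K be the ideal of scalars acting on S like an element of J. It contains J and the
    determinant of 1 - G, which kills S. If K lay in a maximal ideal m, the Gram matrix G would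
    vanish modulo m and that determinant would be 1 there. *)
Lemma nakayama (S : E -> Prop) (I : finType) (z y : I -> E) (J : {pred R}) :
  dual_frame S z y -> ideal_closed J ->
  (forall m, maximal_ideal m -> {subset J <= m} ->
     forall i j, b (y i) (z j) \in m) ->
  exists2 t, t \in J & forall s, S s -> t *: s = s.
Proof.
move=> /dual_frame_ord; set z' := z \o _; set y' := y \o _ => zy hJ h.
pose K : {pred R} := fun r => `[< exists2 t, t \in J &
  forall s, S s -> r *: s = t *: s >].
have hK : ideal_closed K.
  apply: ideal_closedP; first by exists 0 => //; exact: ideal0.
  move=> r u v [t tJ ht] [t' t'J ht']; exists (r * t + t').
    by rewrite idealD ?ideal_mull.
  by move=> s Ss; rewrite !scalerDl -!scalerA ht // ht'.
have [/asboolP [t tJ ht]|nK] := boolP (1 \in K).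
  by exists t => // s Ss; rewrite -ht // scale1r.
have [m mm Km] := exists_maximal_ideal hK nK; have [hm m1 _] := mm.
have Jm : {subset J <= m} by move=> t tJ; apply: Km; apply/asboolP; exists t.
case/negP: m1.
set G := \matrix_(i, j) b (y' i) (z' j).
have dm : \det (1%:M - G) \in m.
  apply: Km; apply/asboolP; exists 0; first exact: ideal0.
  by move=> s Ss; rewrite (dual_frame_det zy) // scale0r.
suff h1 : \det (1%:M : 'M[R]_#|I|) - \det (1%:M - G) \in m.
  by have := idealD hm h1 dm; rewrite subrK det1.
apply: det_congr => // i j; rewrite !mxE.
have -> (u v : R) : u - (u - v) = v by ring.
exact: h.
Qed.

(* S is a unimodular subspace of E. *)
Record regular (S : E -> Prop) : Prop := Regular {
  reg0 : S 0;
  regP : forall r x y, S x -> S y -> S (r *: x + y);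
  reg_frame : exists (I : finType) (z y : I -> E),
    [/\ forall i, S (z i), forall i, S (y i) & dual_frame S z y] }.

Section Regular.
Variable S : E -> Prop.
Hypothesis hS : regular S.

Lemma regD x y : S x -> S y -> S (x + y).
Proof. by move=> Sx Sy; rewrite -[x]scale1r; apply: regP. Qed.

Lemma regZ r x : S x -> S (r *: x).
Proof. by move=> Sx; rewrite -[_ *: x]addr0; apply: regP => //; exact: reg0. Qed.

Lemma regN x : S x -> S (- x).
Proof. by rewrite -scaleN1r; exact: regZ. Qed.

Lemma regB x y : S x -> S y -> S (x - y).
Proof. by move=> Sx Sy; apply: regD => //; apply: regN. Qed.

Lemma reg_idempotent e : e * e = e -> regular (fun s => S s /\ e *: s = s).
Proof.
move=> ee; split.
- by split; [exact: reg0|rewrite scaler0].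
- move=> r x y [Sx ex] [Sy ey]; split; first exact: regP.
  by rewrite scalerDr ey scalerA mulrC -scalerA ex.
case: (reg_frame hS) => I [z [y [Sz Sy zy]]].
exists I, (fun i => e *: z i), (fun i => e *: y i); split=> [i|i|s [Ss es]].
- by split; [exact: regZ|rewrite scalerA ee].
- by split; [exact: regZ|rewrite scalerA ee].
rewrite -{1}es {1}(zy s Ss) scaler_sumr; apply: eq_bigr => i _.
by rewrite sbZl !scalerA; congr (_ *: _); ring: ee.
Qed.

(** The orthogonal projection [pr] carries a frame of S to one of the complement; d serves as
    inverse of [b x x] on the support of x. *)
Lemma reg_perp x d : S x -> d * d * b x x = d -> (d * b x x) *: x = x ->
  regular (fun s => S s /\ b x s = 0).
Proof.
move=> Sx ddx dx; split.
- by split; [exact: reg0|rewrite sb0r].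
- move=> r s t [Ss bs] [St bt]; split; first exact: regP.
  by rewrite sbDr sbZr bs bt mulr0 addr0.
have bxx s : d * b x x * b x s = b x s by rewrite -sbZl dx.
case: (reg_frame hS) => I [z [y [Sz Sy zy]]].
pose pr s := s - (d * b x s) *: x.
have Spr s : S s -> S (pr s) by move=> Ss; apply: regB => //; apply: regZ.
have bpr s : b x (pr s) = 0.
  by rewrite /pr sbBr sbZr; ring: (bxx s).
exists I, (fun i => pr (z i)), (fun i => pr (y i)); split=> [i|i|s [Ss bs]].
- by split=> //; apply: Spr.
- by split=> //; apply: Spr.
have bys i : b (pr (y i)) s = b (y i) s.
  by rewrite /pr sbBl sbZl bs mulr0 subr0.
transitivity (pr (\sum_i b (y i) s *: z i)).
  by rewrite -(zy s Ss) /pr bs mulr0 scale0r subr0.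
rewrite /pr sb_sumr mulr_sumr scaler_suml -sumrB.
apply: eq_bigr => i _; rewrite bys scalerBr sbZr scalerA.
by congr (_ - _ *: _); ring.
Qed.

End Regular.

(* Rank less than n, in the weak sense that n mutually orthogonal vectors of  *)
(* S have a Gram determinant killing S.                                       *)
Definition rank_lt n (S : E -> Prop) := forall x : nat -> E,
  (forall i, (i < n)%N -> S (x i)) ->
  (forall i j, (i < j < n)%N -> b (x i) (x j) = 0) ->
  forall s, S s -> (\prod_(i < n) b (x i) (x i)) *: s = 0.

Lemma reg_rank_lt S : regular S -> exists n, rank_lt n S.
Proof.
move=> hS; case: (reg_frame hS) => I [z [y [Sz Sy /dual_frame_ord]]].
set z' := z \o _; set y' := y \o _ => zy; set n := #|_| in z' y' zy.
exists n.+1 => x Sx xx s Ss.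
suff -> : \prod_(i < n.+1) b (x i) (x i) = 0 by rewrite scale0r.
(* The Gram matrix of n + 1 vectors factors through R^n. A zero column in B and a zero row in C make
   the factors square, so its determinant is 0. *)
pose B := \matrix_(i < n.+1, k < 1 + n) (if split k is inr k then b (x i) (z' k) else 0).
pose C := \matrix_(k < 1 + n, j < n.+1) (if split k is inr k then b (y' k) (x j) else 0).
have <- : \det (B *m C) = \prod_(i < n.+1) b (x i) (x i).
  have -> : B *m C = diag_mx (\row_i b (x i) (x i)).
    apply/matrixP => i j; rewrite !mxE big_split_ord big_ord1 /= !mxE.
    case: split_ordP => // k _; rewrite mul0r add0r.
    transitivity (b (x i) (x j)).
      rewrite [in RHS](zy (x j)); last exact: Sx.
      rewrite sb_sumr; apply: eq_bigr => l _; rewrite !mxE.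
      by rewrite (unsplitK (inr l)) sbZr mulrC.
    have [<-|/eqP ij] := eqVneq i j; first by rewrite mulr1n.
    rewrite mulr0n; have [lt|lt|/val_inj//] := ltngtP i j.
      by apply: xx; rewrite lt /=.
    by rewrite sbC //; apply: xx; rewrite lt /=.
  by rewrite det_diag; apply: eq_bigr => i _; rewrite mxE.
by rewrite det_mulmx (expand_det_col B ord0) big1 ?mul0r // => i _;
   rewrite mxE; case: split_ordP => [k _|k /(congr1 val)//]; rewrite mul0r.
Qed.

(** * Anisotropic vectors and orthogonal bases over a semilocal ring *)

Section Semilocal.
Variable h : R.
Hypothesis h2 : 2%:R * h = 1.
Hypothesis R_semilocal : semilocal R.

Lemma polar x y : b x y = h * (b (x + y) (x + y) - b x x - b y y).
Proof. by rewrite !sbE (sbC hb y x); ring: h2. Qed.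

(* A vector whose value generates the support of S. *)
Lemma reg_anisotropic S : regular S ->
  exists x d, [/\ S x, d * d * b x x = d & forall s, S s -> (d * b x x) *: s = s].
Proof.
move=> hS; case: (reg_frame hS) => I [z [y [Sz Sy zy]]].
(* By polarization, if all values lie in m then so do all products; one of the two alternatives is
   thus available at each m. *)
pose Q (m : {pred R}) x := b x x \notin m \/ forall s t, S s -> S t -> b s t \in m.
have [x Sx Qx] : exists2 x, S x & forall m, maximal_ideal m -> Q m x.
  apply: (semilocal_select R_semilocal) => [||m x u r mm Sx Su rm|m mm].
  - exact: reg0.
  - exact: regP.
  - case=> [bm|]; [left|by right].
    have [hm _ _] := mm.
    have -> : b (r *: u + x) (r *: u + x) = r * (r * b u u + 2%:R * b u x) + b x x.
      by rewrite !sbE (sbC hb x u); ring.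
    by rewrite idealDr // ideal_mulr.
  have [hm m1 _] := mm.
  have [[x Sx bx]|nx] := pselect (exists2 x, S x & b x x \notin m).
    by exists x => //; left.
  exists 0; first exact: reg0.
  have bm x : S x -> b x x \in m.
    by move=> Sx; apply/negPn/negP => bx; apply: nx; exists x.
  right => s t Ss St; rewrite polar ideal_mull // !idealB //; apply: bm => //.
  exact: regD.
pose J : {pred R} := fun r => `[< exists t, r = t * b x x >].
have hJ : ideal_closed J.
  apply: ideal_closedP; first by exists 0; rewrite mul0r.
  by move=> r _ _ [u ->] [v ->]; exists (r * u + v); ring.
have [_ /asboolP[t ->] ht] : exists2 t, t \in J & forall s, S s -> t *: s = s.
  apply: (nakayama zy hJ) => m mm Jm i j.
  have [/negP[]|] := Qx m mm; last by apply.
  by apply: Jm; apply/asboolP; exists 1; rewrite mul1r.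
have tc : t * b x x * b x x = b x x by rewrite -sbZl ht.
(* The scalar t inverts [b x x] on S but may be nonzero off the support; the factor [t * b x x] cuts
   it down so that [d * d * b x x = d]. *)
exists x, (t * t * b x x); split=> // [|s Ss]; first by ring: tc.
have -> : t * t * b x x * b x x = t * b x x by ring: tc.
exact: ht.
Qed.

Lemma rank_lt_perp n S x d : regular S -> S x ->
  (forall s, S s -> (d * b x x) *: s = s) -> rank_lt n.+1 S ->
  rank_lt n (fun s => S s /\ b x s = 0).
Proof.
move=> hS Sx dx hn w Sw ww s [Ss bs].
pose v i := if i is i.+1 then w i else x.
have := hn v _ _ s Ss; rewrite big_ord_recl /= => hv.
rewrite -[LHS]dx; last by apply: regZ.
rewrite -scalerA [b x x *: _]scalerA hv ?scaler0 //.
  by case=> [_|i /Sw []].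
by case=> [|i] [|j] //; [move=> /Sw[]|exact: ww].
Qed.

Fixpoint orthogonal_seq (l : seq (E * R)) : Prop :=
  if l is p :: l then
    (forall q, q \in l -> b p.1 q.1 = 0) /\ orthogonal_seq l
  else True.

Definition anisotropic_pair (p : E * R) :=
  p.2 * p.2 * b p.1 p.1 = p.2 /\ (p.2 * b p.1 p.1) *: p.1 = p.1.

(** Anisotropic vectors are split off until the rank bound is exhausted. The result is applied to A
    with its trace form, so that x A can be cancelled one vector at a time. *)
Lemma reg_orthogonal_basis S : regular S -> exists l : seq (E * R),
  [/\ orthogonal_seq l, forall p, p \in l -> S p.1 /\ anisotropic_pair p
    & forall s, S s -> (forall p, p \in l -> b p.1 s = 0) -> s = 0].
Proof.
move=> hS; have [n] := reg_rank_lt hS; elim: n S hS => [|n IH] S hS hn.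
  exists [::]; split=> // s Ss _.
  suff: (\prod_(i < 0) b 0 0) *: s = 0 by rewrite big_ord0 scale1r.
  by apply: (hn (fun=> 0)) => // i j; rewrite ltn0 andbF.
have [x [d [Sx ddx dx]]] := reg_anisotropic hS.
have [l [ol al l0]] := IH _ (reg_perp hS Sx ddx (dx x Sx)) (rank_lt_perp hS Sx dx hn).
exists ((x, d) :: l); split=> [|p|s Ss hs].
- by split=> // q /al [[]].
- by rewrite inE => /orP [/eqP ->|/al [[]]//]; split=> //; split=> //; apply: dx.
- apply: l0 => [|p pl]; last by apply: hs; rewrite inE pl orbT.
  by split=> //; apply: (hs (x, d)); rewrite inE eqxx.
Qed.

End Semilocal.
End Bilinear.

(** * Witt cancellation *)

Section Isometries.
Variables (R : comPzRingType) (E E' : lmodType R).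
Variables (b : E -> E -> R) (b' : E' -> E' -> R).

Record isometry_on (S : E -> Prop) (S' : E' -> Prop) (g : E -> E') : Prop :=
  IsometryOn {
    isoP : forall r x y, S x -> S y -> g (r *: x + y) = r *: g x + g y;
    isoE : forall x y, S x -> S y -> b' (g x) (g y) = b x y;
    iso_sub : forall x, S x -> S' (g x);
    iso_surj : forall y, S' y -> exists2 x, S x & g x = y }.

Lemma isometry_perp S S' g x : isometry_on S S' g -> S x ->
  isometry_on (fun s => S s /\ b x s = 0) (fun s => S' s /\ b' (g x) s = 0) g.
Proof.
move=> hg Sx; split.
- by move=> r u v [Su _] [Sv _]; exact: (isoP hg).
- by move=> u v [Su _] [Sv _]; exact: (isoE hg).
- by move=> u [Su bu]; split; [exact: (iso_sub hg)|rewrite (isoE hg)].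
- move=> _ [/(iso_surj hg)[u Su <-]]; rewrite (isoE hg) // => bu.
  by exists u.
Qed.

End Isometries.

Lemma isometry_comp (R : comPzRingType) (E E' E'' : lmodType R)
    (b : E -> E -> R) (b' : E' -> E' -> R) (b'' : E'' -> E'' -> R) S S' S'' g g' :
  isometry_on b b' S S' g -> isometry_on b' b'' S' S'' g' ->
  isometry_on b b'' S S'' (g' \o g).
Proof.
move=> hg hg'; have sub := iso_sub hg; split=> /=.
- by move=> r x y Sx Sy; rewrite (isoP hg) // (isoP hg') //; apply: sub.
- by move=> x y Sx Sy; rewrite (isoE hg') ?(isoE hg) //; apply: sub.
- by move=> x /sub /(iso_sub hg').
- by move=> z /(iso_surj hg')[y /(iso_surj hg)[x Sx <-] <-]; exists x.
Qed.

Section Transitivity.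
Variables (R : comPzRingType) (E : lmodType R) (b : E -> E -> R).
Hypothesis hb : symmetric_bilinear b.

(* The reflection along z when r * b z z = 1. *)
Definition partial_reflection z r (s : E) := s - (2%:R * r * b z s) *: z.

(** The map is the reflection along z on the part cut out by the idempotent [r * b z z] and the
    identity on the rest; it is its own inverse. *)
Lemma partial_reflectionP S z r : regular b S -> S z -> r * r * b z z = r ->
  isometry_on b b S S (partial_reflection z r).
Proof.
move=> hS Sz rr; rewrite /partial_reflection.
have hsub x : S x -> S (x - (2%:R * r * b z x) *: z).
  by move=> Sx; apply: (regB hS) => //; apply: (regZ hS).
split=> //.
- move=> t x y _ _; rewrite !(sbE hb) scalerBr scalerA addrACA -opprD -scalerDl.
  by congr (_ - _ *: _); ring.
- move=> x y _ _; rewrite !(sbE hb) (sbC hb x z); ring: rr.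
- move=> y Sy; exists (y - (2%:R * r * b z y) *: z); first exact: hsub.
  rewrite -addrA -opprD -scalerDl !(sbE hb).
  have -> : 2%:R * r * b z y + 2%:R * r * (b z y - 2%:R * r * b z y * b z z) = 0.
    by ring: rr.
  by rewrite scale0r subr0.
Qed.

Variable h : R.
Hypothesis h2 : 2%:R * h = 1.
Hypothesis R_semilocal : semilocal R.

(** The bracket after v is [b z z] times [b x x - b (s x) x'], with s the reflection along z. If it
    is a unit, s x - x' is anisotropic and a second reflection carries s x to x'. At a maximal
    ideal, z = x works unless [b x x + b x x'] vanishes there, and then z = y works because y is
    orthogonal to x and [b x x - b x x'] is congruent to [2 * b x x]. Always using two reflections
    allows these choices to be glued. *)
Lemma reflections_choice S x x' y e d1 :
  regular b S -> S x -> S x' -> S y -> b x y = 0 -> b x' x' = b x x ->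
  e * b x x = d1 * b y y -> d1 * b y y * (d1 * b y y) = d1 * b y y ->
  exists z u v, [/\ S z,
    [/\ u * b z z = d1 * b y y, u * (d1 * b y y) = u & u * u * b z z = u],
    v * (b z z * (b x x - b x x') + 2%:R * b z x * b z x') = d1 * b y y &
    v * (d1 * b y y) = v].
Proof.
move=> hS Sx Sx' Sy bxy bx' ec e11; set e1 := d1 * b y y in ec e11 *.
pose F z := b z z * (b x x - b x x') + 2%:R * b z x * b z x'.
have [z Sz Qz] : exists2 z, S z & forall m, maximal_ideal m ->
    e1 \notin m -> b z z \notin m /\ F z \notin m.
  apply: (semilocal_select R_semilocal) => [||m z s r mm Sz Ss rm Qz em|m mm].
  - exact: reg0 hS.
  - exact: regP hS.
  - have [hm _ _] := mm; have [bz Fz] := Qz em.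
    pose t := r * b s s + 2%:R * b s z.
    have -> : b (r *: s + z) (r *: s + z) = r * t + b z z.
      by rewrite !(sbE hb) (sbC hb z s) /t; ring.
    split; first by rewrite idealDr // ideal_mulr.
    have -> : F (r *: s + z) = r * (t * (b x x - b x x') + 2%:R * b s x * (r * b s x' + b z x')
         + 2%:R * b z x * b s x') + F z.
      by rewrite /F !(sbE hb) (sbC hb z s) /t; ring.
    by rewrite idealDr // ideal_mulr.
  have [hm m1 _] := mm.
  have [em|em] := boolP (e1 \in m).
    by exists 0; [exact: reg0 hS|].
  have cm : b x x \notin m by apply: contra em => cm; rewrite -ec ideal_mull.
  have ym : b y y \notin m by apply: contra em => ym; rewrite ideal_mull.
  have h2m u : 2%:R * u \in m -> u \in m.
    by move=> um; have -> : u = h * (2%:R * u) by [ring: h2]; rewrite ideal_mull.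
  have [pm|pm] := boolP (b x x + b x x' \in m); last first.
    exists x => // _; split=> //.
    have -> : F x = b x x * (b x x + b x x') by rewrite /F; ring.
    by rewrite maximal_idealM // negb_or cm.
  exists y => // _; split=> //.
  rewrite /F (sbC hb y x) bxy mulr0 mul0r addr0 maximal_idealM // negb_or ym /=.
  apply: contra cm => qm; apply: h2m.
  have -> : 2%:R * b x x = (b x x - b x x') + (b x x + b x x') by ring.
  exact: idealD.
have [u [uz ue uu]] := unit_on_idempotent e11 (fun m mm em => proj1 (Qz m mm em)).
have [v [vF ve _]] := unit_on_idempotent e11 (fun m mm em => proj2 (Qz m mm em)).
by exists z, u, v.
Qed.

(* Where the orthogonal complement of x is nonzero, two reflections carry x to *)
(* x'; elsewhere x' = l x with l * l = 1, and one partial reflection suffices.  *)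
Lemma reg_transitive S x x' d : regular b S -> S x -> S x' ->
  b x' x' = b x x -> d * d * b x x = d ->
  (d * b x x) *: x = x -> (d * b x x) *: x' = x' ->
  exists2 g, isometry_on b b S S g & g x = x'.
Proof.
move=> hS Sx Sx' bx' ddx dx dx'; set c := b x x in bx' ddx dx dx' *.
set e := d * c in dx dx'.
have ee : e * e = e by rewrite /e; ring: ddx.
have hS0 := reg_idempotent hb hS ee.
have hS1 := reg_perp hb hS0 (conj Sx dx) ddx dx.
have [y [d1 [[[Sy ey] bxy] dd1 id1]]] := reg_anisotropic hb h2 R_semilocal hS1.
set e1 := d1 * b y y in id1.
have e11 : e1 * e1 = e1 by rewrite /e1; ring: dd1.
have eby : e * b y y = b y y by rewrite -(sbZl hb) ey.
have ee1 : e * e1 = e1 by rewrite /e1 mulrCA eby.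
(* On n the complement of x in e S is zero, so x' is there a multiple l of x with l * l = 1; on e1
   the complement is nonzero. *)
pose n := e - e1.
have ne : n * e = n by rewrite /n; ring: ee ee1.
have ne1 : n * e1 = 0 by rewrite /n; ring: e11 ee1.
have nn : n * n = n by rewrite {2}/n mulrBr ne ne1 subr0.
pose l := n * d * b x x'.
have nx' : n *: x' = l *: x.
  have ebx : e * b x x' = b x x' by rewrite -(sbZl hb) dx.
  pose t := x' - (d * b x x') *: x.
  have et : e *: t = t.
    by rewrite scalerBr dx' scalerA mulrC -scalerA dx.
  have e1t : e1 *: t = t.
    apply: id1; split; first by split=> //; apply: (regB hS) => //; apply: (regZ hS).
    rewrite !(sbE hb) -/c; have -> : d * b x x' * c = e * b x x' by rewrite /e; ring.
    by rewrite ebx subrr.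
  have : n *: t = 0 by rewrite scalerBl et e1t subrr.
  by rewrite scalerBr scalerA mulrA => /eqP; rewrite subr_eq0 => /eqP.
have ln : l * n = l by rewrite /l; ring: nn.
have le : l * e = l by rewrite /l; ring: ne.
have le1 : l * e1 = 0 by rewrite -ln -mulrA ne1 mulr0.
have ll : l * l = n.
  have : b (n *: x') (n *: x') = b (l *: x) (l *: x) by rewrite nx'.
  rewrite !(sbE hb) bx' -/c => E1.
  have -> : l * l = (l * (l * c)) * d by rewrite -{1}le /e; ring.
  by rewrite -E1 -{3}ne /e; ring: nn.
(* The idempotent k is the part of n where l = -1; reflecting along x there, and only there, gives
   x' on all of n. *)
pose k := h * (n - l).
have kk : k * k = k.
  have -> : k * k = h * h * (n * n - 2%:R * (l * n) + l * l) by rewrite /k; ring.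
  rewrite nn ln ll; have -> : n - 2%:R * l + n = 2%:R * (n - l) by ring.
  by transitivity (2%:R * h * k); [rewrite /k; ring|rewrite h2 mul1r].
have ke : k * e = k by rewrite /k; ring: ne le.
have ke1 : k * e1 = 0 by rewrite /k; ring: ne1 le1.
have nk : 2%:R * n * k = n - l.
  have -> : 2%:R * n * k = 2%:R * h * (n * n - l * n) by rewrite /k; ring.
  by rewrite h2 nn ln mul1r.
pose r0 := d * k.
have r0c : r0 * c = k by rewrite /r0 -{2}ke /e; ring.
have rr0 : r0 * r0 * c = r0 by rewrite -mulrA r0c /r0; ring: kk.
have [z [u [v [Sz [uz ue uu] vF ve]]]] :
    exists z u v, [/\ S z,
    [/\ u * b z z = e1, u * e1 = u & u * u * b z z = u],
    v * (b z z * (c - b x x') + 2%:R * b z x * b z x') = e1 & v * e1 = v].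
  by apply: (@reflections_choice _ _ _ _ (d * e1)) => //; rewrite mulrAC.
set F := b z z * _ + _ in vF.
have [x1 x1d] : exists x1, x1 = partial_reflection x r0 x by eexists.
have [x2 x2d] : exists x2, x2 = partial_reflection z u x1 by eexists.
have h0 := partial_reflectionP hS Sx rr0; have h1 := partial_reflectionP hS Sz uu.
have x1E : x1 = x - (2%:R * k) *: x.
  by rewrite x1d /partial_reflection -/c -r0c mulrA.
have Sx1 : S x1 by rewrite x1d; apply: (iso_sub h0).
have Sx2 : S x2 by rewrite x2d; apply: (iso_sub h1).
have bx2 : b x2 x2 = c by rewrite x2d (isoE h1) // x1d (isoE h0).
have [z2 z2d] : exists z2, z2 = x2 - x' by eexists.
have Sz2 : S z2 by rewrite z2d; apply: (regB hS).
have bz2 : b z2 z2 = 2%:R * b z2 x2.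
  by rewrite z2d !(sbE hb) bx' bx2 (sbC hb x2 x'); ring.
have e1z2 : e1 * b z2 x2 = u * F.
  have -> : b z2 x2 = c - b x2 x'.
    by rewrite z2d (sbBl hb) bx2 (sbC hb x').
  rewrite x2d /partial_reflection x1E /F.
  rewrite !(sbE hb); ring: ke1 ue uz.
(* Since [b z2 z2] is [2 * F / b z z] on e1, this is its inverse there. The last reflection then
   replaces x2 by x' on e1 and leaves n untouched. *)
pose r2 := h * b z z * v.
have r2z : 2%:R * (r2 * b z2 x2) = e1.
  have -> : 2%:R * (r2 * b z2 x2) = b z z * v * (e1 * b z2 x2).
    by rewrite /r2 -{1}ve; ring: h2.
  by rewrite e1z2; ring: vF uz e11.
have rr2 : r2 * r2 * b z2 z2 = r2.
  rewrite bz2; have -> : r2 * r2 * (2%:R * b z2 x2) = r2 * (2%:R * (r2 * b z2 x2)) by ring.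
  by rewrite r2z /r2 -!mulrA ve.
have h3 := partial_reflectionP hS Sz2 rr2.
exists (partial_reflection z2 r2 \o (partial_reflection z u \o partial_reflection x r0)).
  exact: isometry_comp (isometry_comp h0 h1) h3.
rewrite /= -x1d -x2d /partial_reflection -mulrA r2z z2d.
have nx2 : n *: x2 = n *: x'.
  rewrite x2d /partial_reflection scalerBr scalerA.
  have -> : n * (2%:R * u * b z x1) = 0 by rewrite -ue; ring: ne1.
  rewrite scale0r subr0 x1E scalerBr scalerA mulrCA mulrA nk -scalerBl nx'.
  by congr (_ *: _); ring.
have ex2 : e *: x2 = x2.
  have eu : e * u = u by rewrite -ue; ring: ee1.
  have ex1 : e *: x1 = x1.
    rewrite x1E scalerBr dx scalerA; congr (_ - _ *: _); ring: ke.
  rewrite x2d /partial_reflection scalerBr ex1 scalerA.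
  by congr (_ - _ *: _); ring: eu.
rewrite scalerBr opprB addrCA -{1}ex2 -scalerBl -/n nx2 -scalerDl /n.
by rewrite addrC subrK dx'.
Qed.

End Transitivity.

(** * Algebras with a quadratic trace *)

(* The properties shared by the two kinds of algebras with involution. *)
Record quadratic_trace (R : comPzRingType) (A : algType R) (Tr : A -> R) : Prop :=
  QuadraticTrace {
    qtP : forall r a b, Tr (r *: a + b) = r * Tr a + Tr b;
    qt1 : Tr 1 = 2%:R;
    qtC : forall a b, Tr (a * b) = Tr (b * a);
    qtCH : forall a, exists n : R, a * a = Tr a *: a - n%:A;
    qt_frame : exists (I : finType) (u v : I -> A),
      forall a, a = \sum_i Tr (v i * a) *: u i }.

Section QuadraticTrace.
Variables (R : comPzRingType) (h : R) (A : algType R) (Tr : A -> R).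
Hypothesis h2 : 2%:R * h = 1.
Hypothesis hT : quadratic_trace Tr.
Implicit Types (a b c : A) (r s : R).

Definition invol a : A := (Tr a)%:A - a.
Definition nrm a : R := h * Tr (invol a * a).

Lemma double_inj r s : 2%:R * r = 2%:R * s -> r = s.
Proof. by move=> e; rewrite -[r]mul1r -[s]mul1r -h2 mulrAC e mulrAC. Qed.

Lemma trD a b : Tr (a + b) = Tr a + Tr b.
Proof. by rewrite -{1}[a]scale1r (qtP hT) mul1r. Qed.

Lemma tr0 : Tr 0 = 0.
Proof. by apply: (addrI (Tr 0)); rewrite -trD !addr0. Qed.

Lemma trZ r a : Tr (r *: a) = r * Tr a.
Proof. by rewrite -[r *: a]addr0 (qtP hT) tr0 addr0. Qed.

Lemma trN a : Tr (- a) = - Tr a.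
Proof. by rewrite -scaleN1r trZ mulN1r. Qed.

Lemma trB a b : Tr (a - b) = Tr a - Tr b.
Proof. by rewrite trD trN. Qed.

Lemma trA r : Tr r%:A = 2%:R * r.
Proof. by rewrite trZ (qt1 hT) mulrC. Qed.

Lemma alg_inj r s : r%:A = s%:A :> A -> r = s.
Proof. by move=> /(congr1 Tr); rewrite !trA => /double_inj. Qed.

Lemma conjD a b : invol (a + b) = invol a + invol b.
Proof. by rewrite /invol trD scalerDl opprD addrACA. Qed.

Lemma conjZ r a : invol (r *: a) = r *: invol a.
Proof. by rewrite /invol trZ -scalerA scalerBr. Qed.

Lemma conjA r : invol r%:A = r%:A.
Proof. rewrite /invol trA; module_ring. Qed.

Lemma conj0 : invol 0 = 0.
Proof. by apply: (addrI (invol 0)); rewrite -conjD !addr0. Qed.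

Lemma tr_conj a : Tr (invol a) = Tr a.
Proof. by rewrite trB trA; ring. Qed.

Lemma conjK a : invol (invol a) = a.
Proof. by rewrite {1}/invol tr_conj opprB addrC subrK. Qed.

Lemma symP a : invol a = a -> a = (h * Tr a)%:A.
Proof.
rewrite /invol => /eqP; rewrite subr_eq => /eqP e.
rewrite -scalerA e; transitivity ((2%:R * h) *: a); last by module_ring.
by rewrite h2 scale1r.
Qed.

(** Polarization of the quadratic relation [qtCH]; the scalar term is identified by taking traces,
    since 2 is invertible. *)
Lemma mul_anticomm a b :
  a * b + b * a = Tr a *: b + Tr b *: a - (Tr a * Tr b - Tr (a * b))%:A.
Proof.
have [n hn] := qtCH hT (a + b).
have [na ha] := qtCH hT a; have [nb hb] := qtCH hT b.
have e : a * b + b * a = Tr a *: b + Tr b *: a - (n - na - nb)%:A.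
  have -> : a * b + b * a = (a + b) * (a + b) - a * a - b * b.
    rewrite mulrDl !mulrDr; module_ring.
  rewrite hn ha hb trD; module_ring.
rewrite e; congr (_ - _%:A); apply: double_inj.
have := congr1 Tr e; rewrite !(trD, trN, trZ) (qtC hT b a) (qt1 hT) => e2.
have -> : 2%:R * (n - na - nb) =
  Tr a * Tr b + Tr b * Tr a - (Tr a * Tr b + Tr b * Tr a - (n - na - nb) * 2%:R) by ring.
by rewrite -e2; ring.
Qed.

Lemma conjM a b : invol (a * b) = invol b * invol a.
Proof.
rewrite /invol mulrBl !mulrBr mulr_algl mulr_algr -scalerAl mul1r.
have -> : b * a = Tr a *: b + Tr b *: a - (Tr a * Tr b - Tr (a * b))%:A - a * b.
  by rewrite -mul_anticomm addrAC subrr add0r.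
module_ring.
Qed.

Lemma mul_conj_comm a : a * invol a = invol a * a.
Proof. by rewrite /invol mulrBr mulrBl mulr_algl mulr_algr. Qed.

Lemma mul_conj a : invol a * a = (nrm a)%:A.
Proof. by apply: symP; rewrite conjM conjK. Qed.

Lemma conj_mul a : a * invol a = (nrm a)%:A.
Proof. by rewrite mul_conj_comm mul_conj. Qed.

Lemma trM_conj a : Tr (invol a * a) = 2%:R * nrm a.
Proof. by rewrite mul_conj trA. Qed.

Lemma sqr_tr a : a * a = Tr a *: a - (nrm a)%:A.
Proof.
by rewrite -mul_conj /invol mulrBl mulr_algl opprB addrC subrK.
Qed.

Lemma nrm_conj a : nrm (invol a) = nrm a.
Proof. by rewrite /nrm conjK mul_conj_comm. Qed.

Lemma nrmM a b : nrm (a * b) = nrm a * nrm b.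
Proof.
apply: alg_inj; rewrite -mul_conj conjM mulrA -(mulrA (invol b)) mul_conj.
by rewrite mulr_algr -scalerAl mul_conj scalerA.
Qed.

Lemma nrmZ r a : nrm (r *: a) = r * r * nrm a.
Proof. by rewrite /nrm conjZ -scalerAl -scalerAr !trZ; ring. Qed.

Lemma nrmD a b : nrm (a + b) = nrm a + nrm b + Tr (invol a * b).
Proof.
apply: double_inj; rewrite -trM_conj conjD mulrDl !mulrDr !trD !trM_conj.
have -> : Tr (invol b * a) = Tr (invol a * b).
  by rewrite -tr_conj conjM conjK.
by ring.
Qed.

Lemma nrmN a : nrm (- a) = nrm a.
Proof. by rewrite -scaleN1r nrmZ; ring. Qed.

Lemma tr_conj_symmetric : symmetric_bilinear (fun a b => Tr (invol a * b)).
Proof.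
split=> [a b|r a b c]; first by rewrite -tr_conj conjM conjK.
by rewrite conjD mulrDl trD conjZ -scalerAl trZ.
Qed.

Lemma tr_conj_regular : regular (fun a b => Tr (invol a * b)) (fun=> True).
Proof.
split=> //; have [I [u [v uv]]] := qt_frame hT.
exists I, u, (fun i => invol (v i)); split=> // a _.
by rewrite {1}(uv a); apply: eq_bigr => i _; rewrite conjK.
Qed.

End QuadraticTrace.

(** * Hermitian forms and their trace forms *)

(* act x a is the right action x a. *)
Record hermitian_form (R : comPzRingType) (A : algType R) (Tr : A -> R)
    (E : lmodType R) (act : E -> A -> E) (f : E -> E -> A) : Prop :=
  HermitianForm {
    actDl : forall x y a, act (x + y) a = act x a + act y a;
    actDr : forall x a b, act x (a + b) = act x a + act x b;
    actM : forall x a b, act x (a * b) = act (act x a) b;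
    actA : forall x r, act x r%:A = r *: x;
    hfDr : forall x y z, f x (y + z) = f x y + f x z;
    hfMr : forall x y a, f x (act y a) = f x y * a;
    hfC : forall x y, f x y = invol Tr (f y x) }.

Section HermitianForm.
Variables (R : comPzRingType) (h : R) (A : algType R) (Tr : A -> R).
Hypothesis h2 : 2%:R * h = 1.
Hypothesis hT : quadratic_trace Tr.
Variables (E : lmodType R) (act : E -> A -> E) (f : E -> E -> A).
Hypothesis hf : hermitian_form Tr act f.

Local Notation cj := (invol Tr).

Definition trf x y := Tr (f x y).
Definition qf x := h * trf x x.

Lemma hfDl x y z : f (x + y) z = f x z + f y z.
Proof. by rewrite !(hfC hf _ z) (hfDr hf) conjD. Qed.

Lemma hfMl x y a : f (act x a) y = cj a * f x y.
Proof. by rewrite !(hfC hf _ y) (hfMr hf) (conjM h2 hT). Qed.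

Lemma actZ x r a : act (r *: x) a = r *: act x a.
Proof. by rewrite -!(actA hf) -!(actM hf) mulr_algl mulr_algr. Qed.

Lemma actZr x r a : act x (r *: a) = r *: act x a.
Proof. by rewrite -mulr_algl (actM hf) (actA hf) actZ. Qed.

Lemma actN x a : act (- x) a = - act x a.
Proof. by rewrite -[- x]scaleN1r actZ scaleN1r. Qed.

Lemma act1 x : act x 1 = x.
Proof. by rewrite -[1 in LHS]scale1r (actA hf) scale1r. Qed.

Lemma act0r x : act x 0 = 0.
Proof. by rewrite -[X in act _ X](scale0r 1) (actA hf) scale0r. Qed.

Lemma act0l a : act 0 a = 0.
Proof. by rewrite -[X in act X _](scale0r 0) actZ scale0r. Qed.

Lemma hfZr x y r : f x (r *: y) = r *: f x y.
Proof. by rewrite -(actA hf) (hfMr hf) mulr_algr. Qed.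

Lemma hfZl x y r : f (r *: x) y = r *: f x y.
Proof. by rewrite -(actA hf) hfMl conjA // mulr_algl. Qed.

Lemma hfNr x y : f x (- y) = - f x y.
Proof. by rewrite -[- y]scaleN1r hfZr scaleN1r. Qed.

Lemma hfNl x y : f (- x) y = - f x y.
Proof. by rewrite -[- x]scaleN1r hfZl scaleN1r. Qed.

Lemma hf0r x : f x 0 = 0.
Proof. by rewrite -[X in f _ X](scale0r 0) hfZr scale0r. Qed.

Lemma trf_symmetric : symmetric_bilinear trf.
Proof.
split=> [x y|r x y z]; first by rewrite /trf (hfC hf) tr_conj.
by rewrite /trf hfDl hfZl (qtP hT).
Qed.

Lemma hf_diag x : f x x = (qf x)%:A.
Proof. by apply: (symP h2); rewrite // -(hfC hf). Qed.

Lemma trf_qf x : trf x x = 2%:R * qf x.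
Proof. by rewrite /qf mulrA h2 mul1r. Qed.

(** A frame over A is multiplied by a frame of the trace form of A. *)
Lemma hf_regular (I : finType) (z y : I -> E) :
  (forall x, x = \sum_i act (z i) (f (y i) x)) -> regular trf (fun=> True).
Proof.
move=> zy; split=> //; have [J [u [v uv]]] := qt_frame hT.
exists (I * J)%type, (fun p => act (z p.1) (u p.2)),
  (fun p => act (y p.1) (cj (v p.2))); split=> // x _.
rewrite -(pair_bigA _ (fun i j => trf (act (y i) (cj (v j))) x *: act (z i) (u j))) /=.
rewrite {1}(zy x); apply: eq_bigr => i _.
rewrite {1}(uv (f (y i) x)) (big_morph (act (z i)) (actDr hf (z i)) (act0r (z i))).
by apply: eq_bigr => j _; rewrite actZr /trf hfMl (conjK hT).
Qed.

Lemma hf_split x s t a c : f x s = 0 -> f x t = 0 ->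
  f (act x a + s) (act x c + t) = cj a * f x x * c + f s t.
Proof.
move=> xs xt; have sx : f s x = 0 by rewrite (hfC hf) xs (conj0 hT).
rewrite hfDl !(hfDr hf) !hfMl !(hfMr hf) xt sx.
by rewrite mul0r mulr0 addr0 add0r mulrA.
Qed.

Definition act_closed (S : E -> Prop) := forall x a, S x -> S (act x a).

Definition herm_perp (S : E -> Prop) x s := S s /\ f x s = 0.

Lemma herm_perp_act S x : act_closed S -> act_closed (herm_perp S x).
Proof.
by move=> aS y a [Sy xy]; split; [exact: aS|rewrite (hfMr hf) xy mul0r].
Qed.

Lemma trf_act x a b : trf (act x a) (act x b) = qf x * Tr (cj a * b).
Proof.
rewrite /trf hfMl (hfMr hf) hf_diag mulr_algl -scalerAr trZ //.
Qed.

Definition trf_perp (S : E -> Prop) x (l : seq (A * R)) s :=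
  S s /\ forall p, p \in l -> trf (act x p.1) s = 0.

Lemma trf_perp_nil S x : trf_perp S x [::] = S.
Proof. by apply/funext => s; apply/propext; split=> [[]|]. Qed.

Lemma trf_perp_cons S x p l : trf_perp S x (p :: l) =
  trf_perp (fun s => S s /\ trf (act x p.1) s = 0) x l.
Proof.
apply/funext => s; apply/propext; split=> [[Ss hs]|[[Ss ps] hs]].
  split; first by split=> //; apply: hs; rewrite inE eqxx.
  by move=> q ql; apply: hs; rewrite inE ql orbT.
by split=> // q; rewrite inE => /orP [/eqP ->|/hs].
Qed.

Lemma trf_perp_basis S x (l : seq (A * R)) :
  (forall a, (forall p, p \in l -> Tr (cj p.1 * a) = 0) -> a = 0) ->
  trf_perp S x l = herm_perp S x.
Proof.
move=> l0; apply/funext => s; apply/propext; split=> [[Ss hs]|[Ss xs]].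
  by split=> //; apply: l0 => p /hs; rewrite /trf hfMl.
by split=> // p _; rewrite /trf hfMl xs mulr0 tr0.
Qed.

Lemma trf_act_anisotropic x d p : d * d * trf x x = d -> (d * trf x x) *: x = x ->
  anisotropic_pair (fun a b => Tr (cj a * b)) p ->
  anisotropic_pair trf (act x p.1, 2%:R * d * p.2).
Proof.
case: p => a r ddx dx [/= rra ra]; rewrite /anisotropic_pair /= trf_act.
set n := Tr (cj a * a) in rra ra *; set B := trf x x in ddx dx.
have -> : qf x = h * B by [].
have e : 2%:R * d * r * (h * B * n) = d * B * (r * n).
  by transitivity (2%:R * h * (d * B * (r * n))); [ring|rewrite h2 mul1r].
split; last by rewrite e -scalerA -actZr ra -actZ dx.
have -> : 2%:R * d * r * (2%:R * d * r) * (h * B * n) =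
  2%:R * d * r * (2%:R * d * r * (h * B * n)) by ring.
by rewrite e; ring: ddx rra.
Qed.

End HermitianForm.

(** * From isometries of trace forms to hermitian isometries *)

Section Isometries.
Variables (R : comPzRingType) (h : R) (A : algType R) (Tr : A -> R).
Hypothesis h2 : 2%:R * h = 1.
Hypothesis hT : quadratic_trace Tr.
Hypothesis R_semilocal : semilocal R.
Variables (E E' : lmodType R) (act : E -> A -> E) (act' : E' -> A -> E').
Variables (f : E -> E -> A) (f' : E' -> E' -> A).
Hypotheses (hf : hermitian_form Tr act f) (hf' : hermitian_form Tr act' f').

Let b := trf Tr f.
Let b' := trf Tr f'.
Let hb : symmetric_bilinear b := trf_symmetric h2 hT hf.
Let hb' : symmetric_bilinear b' := trf_symmetric h2 hT hf'.

Lemma isometryZ S S' g : isometry_on b b' S S' g -> S 0 ->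
  forall r x, S x -> g (r *: x) = r *: g x.
Proof.
move=> hg S0 r x Sx.
have g0 : g 0 = 0.
  have := isoP hg 1 S0 S0; rewrite !scale1r addr0 => e.
  by apply: (addrI (g 0)); rewrite -e addr0.
by rewrite -[r *: x]addr0 (isoP hg) // g0 addr0.
Qed.

(* Witt cancellation of the subspaces x A and x' A. *)
Lemma isometry_trf_perp x x' d l :
  b' x' x' = b x x -> d * d * b x x = d ->
  (d * b x x) *: x = x -> (d * b x x) *: x' = x' ->
  orthogonal_seq (fun a c => Tr (invol Tr a * c)) l ->
  (forall p, p \in l -> anisotropic_pair (fun a c => Tr (invol Tr a * c)) p) ->
  forall S S' g, regular b S -> regular b' S' -> isometry_on b b' S S' g ->
  (forall p, p \in l -> S (act x p.1)) -> (forall p, p \in l -> S' (act' x' p.1)) ->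
  [/\ regular b (trf_perp Tr act f S x l), regular b' (trf_perp Tr act' f' S' x' l)
    & exists g', isometry_on b b' (trf_perp Tr act f S x l)
        (trf_perp Tr act' f' S' x' l) g'].
Proof.
move=> bx ddx dx dx'.
have qx : qf h Tr f' x' = qf h Tr f x by rewrite /qf -/b' -/b bx.
elim: l => [|p l IH] /= ol al S S' g hS hS' hg Sx Sx'.
  by rewrite !trf_perp_nil; split=> //; exists g.
have pl : p \in p :: l by rewrite inE eqxx.
have ll q : q \in l -> q \in p :: l by move=> ql; rewrite inE ql orbT.
have [op ol'] := ol; have ap := al p pl.
have [/= Dy Dyy] := trf_act_anisotropic h2 hT hf ddx dx ap.
have [/= Dy' Dyy'] : anisotropic_pair b' (act' x' p.1, 2%:R * d * p.2).
  by apply: (trf_act_anisotropic h2 hT hf') => //; rewrite -/b' bx.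
have Sy := Sx p pl; have Sy' := Sx' p pl.
have byy : b' (act' x' p.1) (act' x' p.1) = b (act x p.1) (act x p.1).
  by rewrite /b /b' (trf_act h2 hT hf) (trf_act h2 hT hf') qx.
set D := 2%:R * d * p.2 in Dy Dyy Dy' Dyy'.
set y := act x p.1 in Sy Dy Dyy byy; set y' := act' x' p.1 in Sy' Dy' Dyy' byy.
have bgy : b' (g y) (g y) = b y y by apply: (isoE hg).
(* Correcting g by an isometry of S' that moves [g y] to [y'] makes it restrict to the orthogonal
   complements of y and y'. *)
have [||||k hk ky] := @reg_transitive _ _ _ hb' _ h2 R_semilocal S' (g y) y' D
    hS' (iso_sub hg Sy) Sy'.
- by rewrite byy bgy.
- by rewrite bgy.
- by rewrite bgy -(isometryZ hg) ?Dyy //; exact: reg0 hS.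
- by rewrite bgy -byy.
have := isometry_perp (isometry_comp hg hk) Sy; rewrite /= ky => hgk.
rewrite !trf_perp_cons; apply: IH hgk _ _ => //.
- by move=> q /ll /al.
- refine (reg_perp hb hS Sy Dy Dyy).
- refine (reg_perp hb' hS' Sy' Dy' Dyy').
- move=> q ql; split; first exact: Sx (ll q ql).
  by rewrite /b /y (trf_act h2 hT hf) op // mulr0.
- move=> q ql; split; first exact: Sx' (ll q ql).
  by rewrite /b' /y' (trf_act h2 hT hf') op // mulr0.
Qed.

Record herm_isometry (S : E -> Prop) (S' : E' -> Prop) (g : E -> E') : Prop :=
  HermIsometry {
    hisoD : forall x y, S x -> S y -> g (x + y) = g x + g y;
    hisoM : forall x a, S x -> g (act x a) = act' (g x) a;
    hisoE : forall x y, S x -> S y -> f' (g x) (g y) = f x y;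
    hiso_sub : forall x, S x -> S' (g x);
    hiso_surj : forall y, S' y -> exists2 x, S x & g x = y }.

(** S is the orthogonal sum of x A and the hermitian complement of x, and likewise for S'. Both x
    and x' have the same value, so sending x to x' and using g1 on the complement preserves the
    forms. *)
Lemma herm_isometry_extend S S' x x' d g1 :
  regular b S -> act_closed act S -> S x -> regular b' S' -> act_closed act' S' -> S' x' ->
  b' x' x' = b x x ->
  (forall s, S s -> (d * b x x) *: s = s) -> (forall s, S' s -> (d * b x x) *: s = s) ->
  herm_isometry (herm_perp f S x) (herm_perp f' S' x') g1 ->
  exists g, herm_isometry S S' g.
Proof.
move=> hS aS Sx hS' aS' Sx' bx dx dx' h1.
have qx : qf h Tr f' x' = qf h Tr f x by rewrite /qf -/b' -/b bx.
pose c := 2%:R * d; have cq : qf h Tr f x * c = d * b x x.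
  rewrite /c /qf -/b; transitivity (2%:R * h * (d * b x x)); first by ring.
  by rewrite h2 mul1r.
pose co s := c *: f x s; pose co' s := c *: f' x' s.
pose pr s := s - act x (co s); pose pr' s := s - act' x' (co' s).
have hco s : S s -> f x x * co s = f x s.
  move=> Ss; rewrite (hf_diag h2 hf) mulr_algl scalerA cq.
  by rewrite -(hfZr hf) dx.
have hco' s : S' s -> f' x' x' * co' s = f' x' s.
  move=> Ss; rewrite (hf_diag h2 hf') qx mulr_algl scalerA cq.
  by rewrite -(hfZr hf') dx'.
have Spr s : S s -> herm_perp f S x (pr s).
  move=> Ss; split; first by apply: (regB hS) => //; apply: aS.
  by rewrite (hfDr hf) (hfNr hf) (hfMr hf) hco // subrr.
have Spr' s : S' s -> herm_perp f' S' x' (pr' s).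
  move=> Ss; split; first by apply: (regB hS') => //; apply: aS'.
  by rewrite (hfDr hf') (hfNr hf') (hfMr hf') hco' // subrr.
have prD s t : pr (s + t) = pr s + pr t.
  by rewrite /pr /co (hfDr hf) scalerDr (actDr hf) opprD addrACA.
have prM s a : pr (act s a) = act (pr s) a.
  by rewrite /pr /co (hfMr hf) (actDl hf) (actN hf) -(actM hf) -scalerAl.
have prK s : s = act x (co s) + pr s by rewrite /pr addrC subrK.
exists (fun s => act' x' (co s) + g1 (pr s)); split.
- move=> s t Ss St; rewrite prD (hisoD h1); [|exact: Spr|exact: Spr].
  by rewrite /co (hfDr hf) scalerDr (actDr hf') addrACA.
- move=> s a Ss; rewrite prM (hisoM h1); last exact: Spr.
  by rewrite (actDl hf') /co (hfMr hf) -(actM hf') -scalerAl.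
- move=> s t Ss St; rewrite [in RHS](prK s) [in RHS](prK t).
  have [Sps xps] := Spr s Ss; have [Spt xpt] := Spr t St.
  have [S1s x1s] := hiso_sub h1 (Spr s Ss); have [S1t x1t] := hiso_sub h1 (Spr t St).
  rewrite (hf_split h2 hT hf) // (hf_split h2 hT hf') // (hisoE h1); try exact: Spr.
  by rewrite (hf_diag h2 hf) (hf_diag h2 hf') qx.
- move=> s Ss; apply: (regD hS'); first exact: aS'.
  by have [] := hiso_sub h1 (Spr s Ss).
- move=> t St; have [u [Su xu] gu] := hiso_surj h1 (Spr' t St).
  exists (act x (co' t) + u); first by apply: (regD hS) => //; apply: aS.
  have cot : co (act x (co' t) + u) = co' t.
    rewrite /co (hfDr hf) xu addr0 (hfMr hf) (hf_diag h2 hf) -qx.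
    by rewrite -(hf_diag h2 hf') hco'.
  by rewrite /pr cot addrAC subrr add0r gu /pr' addrC subrK.
Qed.

(** The given R-isometry serves only to find x' = g x of the same value and, after Witt
    cancellation, an R-isometry of the hermitian complements. The induction is on the bound for the
    R-rank. *)
Lemma isometry_herm n : forall S S' g, regular b S -> act_closed act S ->
  regular b' S' -> act_closed act' S' -> rank_lt b n S ->
  isometry_on b b' S S' g -> exists g', herm_isometry S S' g'.
Proof.
have [l [ol al l0]] := reg_orthogonal_basis (tr_conj_symmetric h2 hT) h2
  R_semilocal (tr_conj_regular hT).
have {}l0 a : (forall p, p \in l -> Tr (invol Tr p.1 * a) = 0) -> a = 0 by exact: l0.
elim: n => [|n IH] S S' g hS aS hS' aS' hn hg.
  have S0 s : S s -> s = 0.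
    move=> Ss; suff: (\prod_(i < 0) b 0 0) *: s = 0 by rewrite big_ord0 scale1r.
    by apply: (hn (fun=> 0)) => // i j; rewrite ltn0 andbF.
  exists g; have g0 : g 0 = 0.
    by rewrite -[X in g X](scale0r 0) (isometryZ hg) ?scale0r //; exact: reg0 hS.
  split=> //.
  - by move=> x y /S0 -> /S0 ->; rewrite !addr0 g0 addr0.
  - by move=> x a /S0 ->; rewrite (act0l hf) g0 (act0l hf').
  - by move=> x y /S0 -> /S0 ->; rewrite g0 (hf0r hf) (hf0r hf').
  - exact: (iso_sub hg).
  - exact: (iso_surj hg).
have [x [d [Sx ddx dx]]] := reg_anisotropic hb h2 R_semilocal hS.
have Sgx := iso_sub hg Sx; have bgx : b' (g x) (g x) = b x x := isoE hg Sx Sx.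
have dx' s : S' s -> (d * b x x) *: s = s.
  move=> /(iso_surj hg)[u Su <-]; rewrite -(isometryZ hg) ?dx //.
  exact: reg0 hS.
have [|||h1 h1' [k hk]] := isometry_trf_perp bgx ddx (dx x Sx) (dx' _ Sgx) ol _ hS hS' hg _ _.
- by move=> p /al [].
- by move=> p _; apply: aS.
- by move=> p _; apply: aS'.
rewrite !(trf_perp_basis h2 hT hf _ _ l0, trf_perp_basis h2 hT hf' _ _ l0) in h1 h1' hk.
have [||| g1 hg1] := IH _ _ k h1 _ h1' _ _ hk.
- exact: (herm_perp_act hf).
- exact: (herm_perp_act hf').
(* The hermitian complement lies in the complement of x for the trace form, so the bound drops by at
   least one. *)
- have hx := rank_lt_perp hS Sx dx hn.
  have sub s : herm_perp f S x s -> S s /\ b x s = 0.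
    by move=> [Ss xs]; split=> //; rewrite /b /trf xs (tr0 hT).
  by move=> w Sw ww s /sub; apply: hx => // i /Sw /sub.
exact: (herm_isometry_extend hS aS Sx hS' aS' Sgx bgx dx dx' hg1).
Qed.

End Isometries.

(** * Isotropy *)

Section Isotropy.
Variables (R : comPzRingType) (h : R) (A : algType R) (Tr : A -> R).
Hypothesis h2 : 2%:R * h = 1.
Hypothesis hT : quadratic_trace Tr.
Hypothesis R_semilocal : semilocal R.
Variables (E : lmodType R) (act : E -> A -> E) (f : E -> E -> A).
Hypothesis hf : hermitian_form Tr act f.

Local Notation cj := (invol Tr).
Local Notation nrm := (nrm h Tr).
Local Notation b := (trf Tr f).
Local Notation q := (qf h Tr f).
Let hb : symmetric_bilinear b := trf_symmetric h2 hT hf.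

Lemma qfD x y : q (x + y) = q x + q y + b x y.
Proof.
rewrite /qf !(sbE hb) (sbC hb y x).
by transitivity (h * b x x + h * b y y + 2%:R * h * b x y); [ring|rewrite h2 mul1r].
Qed.

Lemma qfZ r x : q (r *: x) = r * r * q x.
Proof. by rewrite /qf !(sbE hb); ring. Qed.

Lemma qf_act x a : q (act x a) = q x * nrm a.
Proof. by rewrite {1}/qf (trf_act h2 hT hf) (trM_conj h2 hT); ring: h2. Qed.

(* q z times the image of v under the reflection along z. *)
Definition reflect_along v z := q z *: v - b v z *: z.

Lemma reflect_along_isotropic v z : b v v = 0 ->
  f (reflect_along v z) (reflect_along v z) = 0.
Proof.
move=> vv; rewrite (hf_diag h2 hf) {1}/qf.
suff -> : b (reflect_along v z) (reflect_along v z) = 0 by rewrite mulr0 scale0r.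
rewrite /reflect_along !(sbE hb) vv (sbC hb z v) (trf_qf _ h2 f z); ring.
Qed.

(** This locates when [f (reflect_along v z) u] is invertible: either through the norm of [f v u],
    or, when those norms vanish modulo m, through the trace term. *)
Lemma nrm_reflect_along v z s t : f z t = 0 ->
  nrm (f (reflect_along v z) (act z s + t)) =
  q z * q z * (nrm (f v (act z s + t)) - b v z * Tr (cj s * f v t)).
Proof.
move=> zt; set u := act z s + t.
have fzu : f z u = q z *: s.
  by rewrite /u (hfDr hf) zt addr0 (hfMr hf) (hf_diag h2 hf) mulr_algl.
have -> : f (reflect_along v z) u = q z *: (f v u - b v z *: s).
  by rewrite /reflect_along (hfDl hT hf) (hfNl h2 hT hf) !(hfZl h2 hT hf) fzu; module_ring.
rewrite (nrmZ _ hT); congr (_ * _).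
rewrite (nrmD h2 hT) (nrmN _ hT) (nrmZ _ hT) mulrN -scalerAr trN // trZ //.
have -> : Tr (cj (f v u) * s) = nrm s * b v z + Tr (cj s * f v t).
  rewrite -[LHS](tr_conj hT) (conjM h2 hT) (conjK hT) /u (hfDr hf) (hfMr hf).
  rewrite mulrDr trD // mulrA (qtC hT) mulrA (conj_mul h2 hT) mulr_algl trZ //.
by rewrite /trf; ring.
Qed.

(** * Nondegenerate reflections of an isotropic vector at one maximal ideal *)

Section Local.
Variable m : {pred R}.
Hypothesis mm : maximal_ideal m.
Variables v w : E.
Hypotheses (vv : q v = 0) (ww : q w = 0) (vw : b v w \notin m).

Let hm : ideal_closed m. Proof. by case: mm. Qed.

Lemma maximal_idealMn x y : (x * y \notin m) = (x \notin m) && (y \notin m).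
Proof. by rewrite maximal_idealM // negb_or. Qed.

Lemma notin_idealM x y : x \notin m -> y \notin m -> x * y \notin m.
Proof. by rewrite maximal_idealMn => -> ->. Qed.

Lemma notin_idealM_inv x y : x \notin m -> x * y \in m -> y \in m.
Proof. by rewrite maximal_idealM // => /negbTE ->. Qed.

Lemma notin_idealN x : x \notin m -> - x \notin m.
Proof. by apply: contra => /(idealN hm); rewrite opprK. Qed.

Lemma notin2 : 2%:R \notin m.
Proof.
have [_ m1 _] := mm; apply: contra m1 => m2; rewrite -h2.
exact: ideal_mulr.
Qed.

Let reach := exists z u, nrm (f (reflect_along v z) u) \notin m.

Lemma reach_nondegenerate y : nrm (f v y) \notin m -> reach.
Proof.
move=> ny.
(* Adding v times [f v y] to y leaves [f v y] unchanged, as v is isotropic, and raises the value by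
   [2 * nrm (f v y)]. *)
have [z qz fz] : exists2 z, q z \notin m & f v z = f v y.
  have [qy|qy] := boolP (q y \in m); last by exists y.
  exists (y + act v (f v y)); last first.
    by rewrite (hfDr hf) (hfMr hf) (hf_diag h2 hf) vv scale0r mul0r addr0.
  rewrite qfD qf_act vv mul0r addr0 idealDr //.
  rewrite /trf (hfMr hf) (hfC hf y v) (trM_conj h2 hT).
  by apply: notin_idealM => //; exact: notin2.
exists z, z; rewrite -{2}(act1 hf z) -[act z 1]addr0 nrm_reflect_along ?(hf0r hf) //.
rewrite mulr0 tr0 // mulr0 subr0 addr0 (act1 hf) fz.
by apply: notin_idealM => //; apply: notin_idealM.
Qed.

Hypothesis degenerate : forall y, nrm (f v y) \in m.

Lemma reach_orthogonal z t s : f z t = 0 -> q z \notin m -> b v z \notin m ->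
  Tr (cj s * f v t) \notin m -> reach.
Proof.
move=> zt qz vz st; exists z, (act z s + t).
rewrite nrm_reflect_along //; apply: notin_idealM; first exact: notin_idealM.
by rewrite idealDr //; apply: notin_idealN; apply: notin_idealM.
Qed.

(** If some [Tr (cj s * f v y)] is a unit at m, the pair z, y already suffices. Otherwise [b v y]
    vanishes modulo m, and the orthogonal pair z + y, [q y *: z - q z *: y] has trace term congruent
    to [q y * b v z]. *)
Lemma reach_sum z y : f z y = 0 -> q z \notin m -> q y \notin m ->
  q z + q y \notin m -> b v z \notin m -> reach.
Proof.
move=> zy qz qy qzy vz.
have [[s hs]|ns] := pselect (exists s, Tr (cj s * f v y) \notin m).
  exact: reach_orthogonal zy qz vz hs.
have vy : b v y \in m.
  apply/negPn/negP => vy; apply: ns; exists 1.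
  by rewrite -[1]scale1r conjA // scale1r mul1r.
have bzy : b z y = 0 by rewrite /trf zy tr0.
apply: (@reach_orthogonal (z + y) (q y *: z - q z *: y) 1).
- have yz : f y z = 0 by rewrite (hfC hf) zy conj0.
  rewrite (hfDl hT hf) !(hfDr hf) !(hfNr hf) !(hfZr hf) zy yz !(hf_diag h2 hf).
  by module_ring.
- by rewrite qfD bzy addr0.
- by rewrite (sbDr hb) idealDl.
- rewrite -[1]scale1r conjA // scale1r mul1r -/(trf Tr f v _) (sbBr hb) !(sbZr hb).
  rewrite idealDl; [exact: notin_idealM|exact: hm|by rewrite idealN ?ideal_mull].
Qed.

Definition orth_part z x := q z *: x - act z (f z x).

Lemma orth_part_perp z x : f z (orth_part z x) = 0.
Proof.
by rewrite (hfDr hf) (hfNr hf) (hfZr hf) (hfMr hf) (hf_diag h2 hf) mulr_algl subrr.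
Qed.

Lemma qf_orth_part z x : q (orth_part z x) = q z * (q z * q x - nrm (f z x)).
Proof.
rewrite qfD -scaleN1r !qfZ qf_act (sbZl hb) (sbZr hb) /trf (hfMr hf) (hfC hf x z).
by rewrite (trM_conj h2 hT); ring.
Qed.

(** Project x0 and x1 away from z. If both projections y0, y1 are isotropic modulo m, [f z x0] and
    [f z x1] have unit norm, so [f y0 y1] does too, and y0 plus a multiple of y1 is anisotropic. *)
Lemma exists_orthogonal z x0 x1 : f x0 x1 = 0 -> q x0 \notin m -> q x1 \notin m ->
  q z \notin m -> exists2 y, f z y = 0 & q y \notin m.
Proof.
move=> x01 q0 q1 qz.
have [p0|p0] := boolP (q (orth_part z x0) \in m); last first.
  by exists (orth_part z x0) => //; exact: orth_part_perp.
have [p1|p1] := boolP (q (orth_part z x1) \in m); last first.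
  by exists (orth_part z x1) => //; exact: orth_part_perp.
have nz x : q x \notin m -> q (orth_part z x) \in m -> nrm (f z x) \notin m.
  rewrite qf_orth_part => qx /(notin_idealM_inv qz) hx.
  apply: contraNN qx => nx; have := idealD hm hx nx.
  by rewrite subrK => /(notin_idealM_inv qz).
set y0 := orth_part z x0 in p0 *; set y1 := orth_part z x1 in p1 *.
pose a := f x0 z * f z x1.
have fy : f y0 y1 = - (q z *: a).
  rewrite {1}/y0 (hfDl hT hf) (hfNl h2 hT hf) (hfMl h2 hT hf) orth_part_perp mulr0.
  rewrite subr0 (hfZl h2 hT hf) (hfDr hf) (hfNr hf) (hfZr hf) (hfMr hf) x01.
  by rewrite scaler0 add0r scalerN.
exists (y0 + act y1 (cj a)).
  by rewrite (hfDr hf) (hfMr hf) !orth_part_perp mul0r addr0.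
rewrite qfD qf_act addrC idealDl //; last by rewrite idealD // ideal_mulr.
rewrite /trf (hfMr hf) fy mulNr -scalerAl (conj_mul h2 hT) trN // trZ // trA //.
have na : nrm a \notin m.
  rewrite /a (nrmM h2 hT) (hfC hf x0 z) (nrm_conj _ hT).
  by apply: notin_idealM; apply: nz.
apply: notin_idealN; apply: notin_idealM => //.
by apply: notin_idealM => //; exact: notin2.
Qed.

(** With c = [b v w], the vectors w + v and w - v have values c and -c. The first fits [reach_sum]
    unless [q y] is congruent to -c; then w - v has a value congruent to that of y and the sum is a
    unit. The factor c on w - v matches the scaling built into [orth_part]. *)
Lemma reach_degenerate x0 x1 : f x0 x1 = 0 -> q x0 \notin m -> q x1 \notin m -> reach.
Proof.
move=> x01 q0 q1; pose c := b v w; have cm : c \notin m by [].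
have bwv : b w v = c by rewrite (sbC hb).
have bvv : b v v = 0 by rewrite (trf_qf _ h2) vv mulr0.
pose z := w + v; have qz : q z = c by rewrite qfD vv ww bwv !add0r.
have bvz : b v z = c by rewrite (sbDr hb) bvv addr0.
have [|y zy qy] := exists_orthogonal x01 q0 q1 (z := z); first by rewrite qz.
have [czy|czy] := boolP (c + q y \in m); last first.
  by apply: (@reach_sum z y); rewrite ?qz ?bvz.
pose z' := w - v; have qz' : q z' = - c.
  by rewrite qfD -scaleN1r qfZ (sbZr hb) vv ww bwv; ring.
have fzy : f z' y = - (2%:R *: f v y).
  have -> : z' = z - 2%:R *: v by rewrite /z /z'; module_ring.
  by rewrite (hfDl hT hf) zy (hfNl h2 hT hf) (hfZl h2 hT hf) add0r.
have bvz' : b v z' = c by rewrite (sbBr hb) bvv subr0.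
have qy' : q (orth_part z' y) = c * (c * q y + 4%:R * nrm (f v y)).
  by rewrite qf_orth_part qz' fzy (nrmN _ hT) (nrmZ _ hT); ring.
have cy : c * q y + 4%:R * nrm (f v y) \notin m.
  by rewrite idealDl; [exact: notin_idealM|exact: hm|exact: ideal_mull].
apply: (@reach_sum (c *: z') (orth_part z' y)).
- by rewrite (hfZl h2 hT hf) orth_part_perp scaler0.
- rewrite qfZ qz'; apply: notin_idealM; first exact: notin_idealM.
  exact: notin_idealN.
- by rewrite qy'; apply: notin_idealM.
- rewrite qfZ qz' qy'.
  have -> : c * c * - c + c * (c * q y + 4%:R * nrm (f v y)) =
    c * c * (c + q y) + 4%:R * c * nrm (f v y) - 2%:R * (c * c * c) by ring.
  have e : c * c * (c + q y) + 4%:R * c * nrm (f v y) \in m.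
    by apply: idealD => //; apply: ideal_mull.
  rewrite idealDr //.
  apply: notin_idealN; apply: notin_idealM; first exact: notin2.
  by apply: notin_idealM => //; apply: notin_idealM.
- by rewrite (sbZr hb) bvz'; apply: notin_idealM.
Qed.

End Local.

Lemma exists_nondegenerate m v w x0 x1 : maximal_ideal m ->
  q v = 0 -> q w = 0 -> b v w \notin m ->
  f x0 x1 = 0 -> q x0 \notin m -> q x1 \notin m ->
  exists z u, nrm (f (reflect_along v z) u) \notin m.
Proof.
move=> mm vv ww vw x01 q0 q1.
have [[y ny]|ny] := pselect (exists y, nrm (f v y) \notin m).
  exact: reach_nondegenerate ny.
apply: (reach_degenerate mm vv ww vw _ x01) => // y.
by apply/negPn/negP => hy; apply: ny; exists y.
Qed.

Lemma herm_perp_regular S x d : regular b S -> act_closed act S -> S x ->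
  (forall s, S s -> (d * b x x) *: s = s) -> regular b (herm_perp f S x).
Proof.
move=> hS aS Sx dx; split.
- by split; [exact: reg0 hS|exact: hf0r hf _].
- move=> r s t [Ss xs] [St xt]; split; first exact: (regP hS).
  by rewrite (hfDr hf) (hfZr hf) xs xt scaler0 addr0.
case: (reg_frame hS) => I [z [y [Sz Sy zy]]].
pose pr s := s - act x ((2%:R * d) *: f x s).
have Spr s : S s -> herm_perp f S x (pr s).
  move=> Ss; split; first by apply: (regB hS) => //; apply: aS.
  rewrite (hfDr hf) (hfNr hf) (hfMr hf) (hf_diag h2 hf) mulr_algl scalerA.
  have -> : q x * (2%:R * d) = 2%:R * h * (d * b x x) by rewrite /qf; ring.
  by rewrite h2 mul1r -(hfZr hf) dx // subrr.
exists I, (fun i => pr (z i)), (fun i => pr (y i)); split=> [i|i|s [Ss xs]].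
- exact: Spr.
- exact: Spr.
have bys i : b (pr (y i)) s = b (y i) s.
  by rewrite [LHS](sbBl hb) /trf (hfMl h2 hT hf) xs mulr0 tr0 // subr0.
have prs : pr s = s by rewrite /pr xs scaler0 (act0r hf) subr0.
have prZ r t : pr (r *: t) = r *: pr t.
  by rewrite /pr (hfZr hf) !(actZr hf); module_ring.
have prD t u : pr (t + u) = pr t + pr u.
  by rewrite /pr (hfDr hf) scalerDr (actDr hf) opprD addrACA.
have pr0 : pr 0 = 0 by rewrite -[X in pr X](scale0r 0) prZ scale0r.
rewrite -{1}prs {1}(zy s Ss) (big_morph pr prD pr0).
by apply: eq_bigr => i _; rewrite prZ bys.
Qed.

Lemma reflect_along_shift v z r s :
  exists k, reflect_along v (r *: s + z) = reflect_along v z + r *: k.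
Proof.
exists ((r * q s + b s z) *: v - b v z *: s - b v s *: (r *: s + z)).
rewrite /reflect_along qfD qfZ !(sbE hb).
by module_ring.
Qed.

(** The norm depends on z and u only modulo m, as [semilocal_select] demands. *)
Lemma nrm_reflect_shift v z u r s t :
  exists k, nrm (f (reflect_along v (r *: s + z)) (r *: t + u)) =
    r * k + nrm (f (reflect_along v z) u).
Proof.
have [k ->] := reflect_along_shift v z r s.
set T := reflect_along v z; pose a := f T t + f k (r *: t + u).
have -> : f (T + r *: k) (r *: t + u) = f T u + r *: a.
  by rewrite (hfDl hT hf) (hfDr hf T) !(hfZl h2 hT hf) (hfZr hf) /a; module_ring.
exists (r * nrm a + Tr (cj (f T u) * a)).
by rewrite (nrmD h2 hT) (nrmZ _ hT) -scalerAr trZ //; ring.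
Qed.

(* In the proof, e1 cuts out the part of e P of rank at least 2, and n the    *)
(* part of rank 1.                                                            *)
Lemma isotropic_idempotent v w e : regular b (fun=> True) ->
  e != 0 -> e * e = e -> e *: v = v -> b v w = e -> b v v = 0 ->
  exists x y a, [/\ a * a = a, a != 0, f x x = 0 & f x y = a].
Proof.
move=> hE e0 ee ev bvw bvv.
(* Subtracting [h * b w w] times v completes v, w to a hyperbolic pair over R e. *)
wlog [bww ew] : w bvw / b w w = 0 /\ e *: w = w.
  move=> wl; apply: (wl (e *: w - (h * b w w) *: v)).
    by rewrite !(sbE hb) bvw bvv; ring: ee.
  split; last first.
    rewrite scalerBr scalerA ee; congr (_ - _).
    by rewrite -[v in RHS]ev; module_ring.
  rewrite !(sbE hb) (sbC hb w v) bvw bvv.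
  transitivity (e * e * b w w - 2%:R * h * (e * e * b w w)); first by ring.
  by rewrite h2 mul1r subrr.
have qv : q v = 0 by rewrite /qf bvv mulr0.
have qw : q w = 0 by rewrite /qf bww mulr0.
have fvv : f v v = 0 by rewrite (hf_diag h2 hf) qv scale0r.
pose S (s : E) := True /\ e *: s = s.
have hS : regular b S := reg_idempotent hb hE ee.
have aS : act_closed act S by move=> s a [_ es]; split=> //; rewrite -(actZ hf) es.
have [x0 [d0 [Sx0 dd0 id0]]] := reg_anisotropic hb h2 R_semilocal hS.
have hS1 := herm_perp_regular hS aS Sx0 id0.
have [x1 [d1 [[[_ ex1] x01] dd1 id1]]] := reg_anisotropic hb h2 R_semilocal hS1.
set e1 := d1 * b x1 x1 in id1.
have e11 : e1 * e1 = e1 by rewrite /e1; ring: dd1.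
have ee1 : e * e1 = e1 by rewrite /e1 mulrCA -(sbZl hb) ex1.
have e0E : d0 * b x0 x0 * e = e.
  by rewrite -{1}bvw -(sbZl hb) id0 // bvw.
pose n := e - e1.
have nn : n * n = n by rewrite /n; ring: ee ee1 e11.
have ne : n * e = n by rewrite /n; ring: ee ee1.
(* On n every vector is a multiple of x0, so the norm of [n *: f v w] contains the factor
   [n *: f v v = 0]. Having trace n and norm 0, that element is idempotent. *)
have [n0|n0] := eqVneq n 0; last first.
  pose c := 2%:R * d0.
  have nS s : S s -> n *: s = (n * c) *: act x0 (f x0 s).
    move=> Ss; pose t := s - act x0 (c *: f x0 s).
    have St : herm_perp f S x0 t.
      split; first by apply: (regB hS) => //; apply: aS.
      rewrite (hfDr hf) (hfNr hf) (hfMr hf) (hf_diag h2 hf) mulr_algl scalerA.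
      have -> : q x0 * c = 2%:R * h * (d0 * b x0 x0) by rewrite /qf /c; ring.
      by rewrite h2 mul1r -(hfZr hf) id0 // subrr.
    have : n *: t = 0 by rewrite scalerBl (id1 t St); case: St => -[_ ->] _; rewrite subrr.
    by rewrite scalerBr (actZr hf) scalerA => /eqP; rewrite subr_eq0 => /eqP.
  have nf s t : S t -> n *: f s t = (n * c) *: (cj (f x0 s) * f x0 t).
    by move=> St; rewrite -(hfZr hf) (nS t St) (hfZr hf) (hfMr hf) (hfC hf s x0).
  have nv : n * c * nrm (f x0 v) = 0.
    apply: (alg_inj h2 hT); rewrite -scalerA -(mul_conj h2 hT) -nf //.
    by rewrite fvv scaler0 scale0r.
  exists (n *: v), w, (n *: f v w); rewrite !(hfZl h2 hT hf) (hfZr hf) fvv !scaler0.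
  have tra : Tr (n *: f v w) = n by rewrite trZ // -/(trf Tr f v w) bvw.
  split=> //; last first.
    by apply: contraNneq n0 => a0; rewrite -tra a0 tr0.
  rewrite (sqr_tr h2 hT) tra scalerA nn.
  have -> : nrm (n *: f v w) = 0.
    rewrite nf // (nrmZ _ hT) (nrmM h2 hT) (nrm_conj _ hT).
    by transitivity (n * c * (n * c * nrm (f x0 v)) * nrm (f x0 w));
      [ring|rewrite nv mulr0 mul0r].
  by rewrite scale0r subr0.
have eE : e = e1 by apply/eqP; rewrite -subr_eq0 -/n n0.
(* Here e = e1, so x0 and x1 are orthogonal and anisotropic at every maximal ideal avoiding e. *)
pose Q (m : {pred R}) (p : E * E) :=
  e \notin m -> nrm (f (reflect_along v p.1) p.2) \notin m.
have [[z u] _ Qzu] : exists2 p, True & forall m, maximal_ideal m -> Q m p.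
  apply: (semilocal_select R_semilocal (S := fun=> True)) => //.
    move=> m [z u] [s t] r mm _ _ rm Qm em.
    have [k /= ->] := nrm_reflect_shift v z u r s t.
    by have [hm _ _] := mm; rewrite idealDr //; [exact: Qm|exact: ideal_mulr].
  move=> m mm; have [hm _ _] := mm.
  have [em|em] := boolP (e \in m); first by exists (0, 0) => //; rewrite /Q em.
  have notq x d : e = d * b x x * e -> q x \notin m.
    move=> eq; apply: contra em => qm; rewrite eq ideal_mulr // ideal_mull //.
    by rewrite (trf_qf _ h2) ideal_mull.
  have [|||z [u zu]] := exists_nondegenerate mm qv qw _ x01.
  - by rewrite bvw.
  - exact: (notq x0 d0).
  - by apply: (notq x1 d1); rewrite {2}eE -/e1 e11.
  by exists (z, u).
have [k [ke _ _]] := unit_on_idempotent ee Qzu.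
set x := reflect_along v z in ke.
exists x, (act u (k *: cj (f x u))), e%:A.
split.
- by rewrite mulr_algl scalerA ee.
- by apply: contraNneq e0 => /(congr1 Tr) /eqP; rewrite trA // tr0 // => /eqP e2;
    rewrite -[e]mul1r -h2 mulrAC e2 mul0r.
- exact: reflect_along_isotropic.
- by rewrite (hfMr hf) -scalerAr (conj_mul h2 hT) scalerA ke.
Qed.

(** Since M is a summand, projecting a frame of E gives a frame of M. The vector v in M is chosen to
    pair to a unit at each maximal ideal where some element of M does; [nakayama], for the ideal of
    values [b v t], then makes some [b v w] act as 1 on M. *)
Lemma isotropic_summand (M N : E -> Prop) : regular b (fun=> True) ->
  M 0 -> (forall r x y, M x -> M y -> M (r *: x + y)) ->
  N 0 -> (forall r x y, N x -> N y -> N (r *: x + y)) ->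
  (forall x, exists y z, [/\ M y, N z & x = y + z]) ->
  (forall x, M x -> N x -> x = 0) -> (exists2 x, M x & x != 0) ->
  (forall x y, M x -> M y -> b x y = 0) ->
  exists v w e, [/\ e != 0, e * e = e, e *: v = v, b v w = e & b v v = 0].
Proof.
move=> hE M0 Mlin N0 Nlin MN MN0 [x1 Mx1 x10] Miso.
case: (reg_frame hE) => I [z [y [_ _ zy]]].
have /choice [pz hpz] : forall i, exists p, M p /\ N (z i - p).
  by move=> i; have [p [t [Mp Nt e]]] := MN (z i); exists p; split=> //; rewrite e addrAC subrr add0r.
have sumP (T : E -> Prop) (c : I -> R) g : T 0 ->
    (forall r x y, T x -> T y -> T (r *: x + y)) -> (forall i, T (g i)) ->
    T (\sum_i c i *: g i).
  by move=> T0 Tlin Tg; elim/big_rec: _ => // i s _; exact: Tlin.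
have pzy : dual_frame b M pz y.
  move=> s Ms; apply/eqP; rewrite -subr_eq0; apply/eqP; apply: MN0.
    rewrite addrC -scaleN1r; apply: (Mlin) => //; apply: sumP => // i.
    by case: (hpz i).
  rewrite {1}(zy s Logic.I) -sumrB; under eq_bigr do rewrite -scalerBr.
  by apply: sumP => // i; case: (hpz i).
pose Q (m : {pred R}) v := (exists t, b v t \notin m) \/
  (forall s t, M s -> b s t \in m).
have [v Mv Qv] : exists2 v, M v & forall m, maximal_ideal m -> Q m v.
  apply: (semilocal_select R_semilocal) => // [m x u r [hm _ _] _ _ rm|m mm].
    case=> [[t xt]|]; [left|by right].
    by exists t; rewrite !(sbE hb) idealDr // ideal_mulr.
  have [[s [Ms [t st]]]|ns] := pselect (exists s, M s /\ exists t, b s t \notin m).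
    by exists s => //; left; exists t.
  exists 0 => //; right => s t Ms; apply/negPn/negP => st.
  by apply: ns; exists s; split=> //; exists t.
pose J : {pred R} := fun r => `[< exists t, r = b v t >].
have hJ : ideal_closed J.
  apply: ideal_closedP; first by exists 0; rewrite (sb0r hb).
  by move=> r _ _ [s ->] [t ->]; exists (r *: s + t); rewrite !(sbE hb).
have [_ /asboolP[w ->] hw] : exists2 t, t \in J & forall s, M s -> t *: s = s.
  apply: (nakayama hb pzy hJ) => m mm Jm i j; rewrite (sbC hb).
  have [[t /negP[]]|] := Qv m mm; first by apply: Jm; apply/asboolP; exists t.
  by apply; case: (hpz j).
exists v, w, (b v w); split=> //.
- by apply: contraNneq x10 => e0; rewrite -(hw x1 Mx1) e0 scale0r.
- by rewrite -(sbZl hb) hw.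
- exact: hw.
- exact: Miso.
Qed.

End Isotropy.

(** * Transfer *)

Section RowCoordinate.
Variables (R : pzRingType) (n : nat).

Definition row_coord (k : 'I_n) (u : 'rV[R]_n) : R^o := u 0 k.

Fact row_coord_linear k : linear (row_coord k).
Proof. by move=> r u v; rewrite /row_coord !mxE. Qed.

HB.instance Definition _ k :=
  GRing.isLinear.Build R 'rV[R]_n R^o *:%R (row_coord k) (row_coord_linear k).

End RowCoordinate.

(* The right A-module P as a module over R itself (restr P is one over R^c). *)
Section BaseModule.
Variables (R : comPzRingType) (A : algType R) (P : lmodType A^c).

Definition base_module : Type := P.

HB.instance Definition _ := GRing.Zmodule.on base_module.

Definition base_act (x : base_module) (a : A) : base_module := (a : A^c) *: (x : P).

Definition base_scale (r : R) (x : base_module) : base_module := base_act x r%:A.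

Fact base_actM (x : base_module) (a b : A) :
  base_act x (a * b) = base_act (base_act x a) b.
Proof. by rewrite /base_act scalerA. Qed.

Fact base_scaleA r s x : base_scale r (base_scale s x) = base_scale (r * s) x.
Proof. by rewrite /base_scale -base_actM mulr_algl scalerA mulrC. Qed.

Fact base_scale1 : left_id 1 base_scale.
Proof. by move=> x; rewrite /base_scale scale1r [LHS]scale1r. Qed.

Fact base_scaleDr : right_distributive base_scale +%R.
Proof. by move=> r x y; rewrite [LHS]scalerDr. Qed.

Fact base_scaleDl x : {morph base_scale^~ x : r s / r + s}.
Proof. by move=> r s; rewrite /base_scale scalerDl [LHS]scalerDl. Qed.

HB.instance Definition _ := GRing.Zmodule_isLmodule.Build R base_module
  base_scaleA base_scale1 base_scaleDr base_scaleDl.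

End BaseModule.

Section Transfer.
Variables (R : comPzRingType) (h : R) (A : algType R) (Tr : A -> R).
Hypothesis h2 : 2%:R * h = 1.
Hypothesis hT : quadratic_trace Tr.

Section OneSpace.
Variables (P : lmodType A^c) (f : P -> P -> A).
Hypothesis hf : unimodular_hermitian (invol Tr) f.

Local Notation E := (base_module P).
Local Notation act := (@base_act R A P).

Lemma unimodular_hermitian_form : @hermitian_form R A Tr E act f.
Proof.
have c1 : invol Tr 1 = 1 by rewrite -[1]scale1r conjA // scale1r.
split.
- by move=> x y a; exact: (scalerDr (a : A^c) (x : P) y).
- by move=> x a c; exact: (scalerDl (x : P) (a : A^c) c).
- exact: base_actM.
- by [].
- exact: (hermDr hf).
- move=> x y a; rewrite -[x in LHS](scale1r (x : P)).
  by rewrite [LHS](hermZ hf 1 a) c1 mul1r.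
- exact: (herm_sym hf).
Qed.

Lemma unimodular_frame : exists n (z y : 'I_n -> E),
  forall x, x = \sum_i act (z i) (f (y i) x).
Proof.
have [n [i [p ip]]] := herm_fgproj hf.
have /choice [y hy] : forall k, exists y, f y =1 (@row_coord A^c n k \o i).
  by move=> k; exact: (herm_surj hf (@row_coord A^c n k \o i : {linear P -> (A^c)^o})).
exists n, (fun k => p (delta_mx 0 k)), y => x.
rewrite -{1}(ip x) (row_sum_delta (i x)) linear_sum.
by apply: eq_bigr => k _; rewrite linearZ /base_act hy.
Qed.

Lemma unimodular_regular : regular (trf Tr (f : E -> E -> A)) (fun=> True).
Proof.
have [n [z [y zy]]] := unimodular_frame.
exact: (hf_regular h2 hT unimodular_hermitian_form zy).
Qed.

Lemma transfer_unimodular : unimodular_hermitian (@idfun R) (transfer Tr f).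
Proof.
have hF := unimodular_hermitian_form.
have [_ _ [I [z [y [_ _ /dual_frame_ord]]]]] := unimodular_regular.
set z' := z \o _; set y' := y \o _ => zy; set n := #|_| in z' y' zy.
pose b := trf Tr (f : E -> E -> A).
have hb : symmetric_bilinear b := trf_symmetric h2 hT hF.
have bl (r : R) (u v : E) t : b t (r *: u + v) = r * b t u + b t v.
  by rewrite (sbDr hb) (sbZr hb).
have zyE (x : E) : x = \sum_i b (y' i) x *: z' i by apply: zy.
split.
- pose i0 (x : restr P) : 'rV[R^c]_n := \row_k b (y' k) x.
  pose p0 (u : 'rV[R^c]_n) : restr P := \sum_k (u 0 k : R) *: z' k.
  have i0P : linear i0.
    by move=> r u v; apply/rowP => k; rewrite !mxE [LHS]bl mulrC.
  have p0P : linear p0.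
    move=> r u v; rewrite /p0 scaler_sumr -big_split; apply: eq_bigr => k _.
    by rewrite !mxE [_ *: z' k]scalerDl mulrC -scalerA.
  pose i := HB.pack_for {linear restr P -> 'rV[R^c]_n} i0
    (GRing.isLinear.Build _ _ _ _ i0 i0P).
  pose p := HB.pack_for {linear 'rV[R^c]_n -> restr P} p0
    (GRing.isLinear.Build _ _ _ _ p0 p0P).
  exists n, i, p => x; rewrite [RHS](zyE x) /= /p0.
  by apply: eq_bigr => k _; rewrite mxE.
- exact: (sbDl hb).
- by move=> x s t; exact: (sbDr hb).
- have bZ (r s : R) (u v : E) : b (r *: u) (s *: v) = r * b u v * s.
    by rewrite (sbZl hb) (sbZr hb); ring.
  by move=> r s u v; exact: bZ.
- exact: (sbC hb).
- move=> x x' e; rewrite [x]zyE [RHS]zyE; apply: eq_bigr => k _.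
  by rewrite !(sbC hb (y' k)) [b x _]e.
- move=> g; exists (\sum_k (g (z' k) : R) *: y' k) => s.
  rewrite [LHS](sbC hb) (sb_sumr hb) [in RHS](zyE s).
  rewrite linear_sum; apply: eq_bigr => k _.
  by rewrite (sbZr hb) (sbC hb) linearZ.
Qed.

Lemma isotropic_transfer : isotropic f -> isotropic (transfer Tr f).
Proof.
move=> [M [N [[M0 hM] [N0 hN] MN nM Mf]]]; exists M, N; split=> //.
- by split=> // r x y Mx My; exact: hM.
- by split=> // r x y Nx Ny; exact: hN.
- by move=> x y Mx My; rewrite /transfer Mf // tr0.
Qed.

(** With c the conjugate of a, the A-linear map p sending s to x c f(y, s) is idempotent; its image
    is the isotropic summand and its kernel a complement. *)
Lemma isotropic_of_idempotent x y a : a * a = a -> a != 0 -> f x x = 0 ->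
  f x y = a -> isotropic f.
Proof.
have hF := unimodular_hermitian_form.
move=> aa a0 xx xy; pose c := invol Tr a.
have cc : c * c = c by rewrite -(conjM h2 hT) aa.
have yx : f y x = c by rewrite (herm_sym hf) xy.
pose x1 : E := act x c.
have x1c : act x1 c = x1 by rewrite /x1 -(actM hF) cc.
have yx1 : f y x1 = c by rewrite (hfMr hF) yx cc.
pose p (s : P) : P := act x1 (f y s).
have pp s : p (p s) = p s.
  by rewrite /p (hfMr hF) yx1 (actM hF x1) x1c.
have pM (r : A^c) s t : p (r *: s + t) = r *: p s + p t.
  by rewrite /p (hfDr hF) (actDr hF) [f y (r *: s)](hfMr hF) (actM hF).
have p0 : p 0 = 0 by rewrite /p (hf0r hF) (act0r hF).
have px s t : p s = s -> p t = t -> f s t = 0.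
  move=> <- <-; rewrite /p (hfMl h2 hT hF) (hfMr hF) (hfMl h2 hT hF) (hfMr hF) xx.
  by rewrite mul0r mulr0 mul0r mulr0.
exists (fun s => `[< p s = s >]), (fun s => `[< p s = 0 >]); split.
- split; first exact/asboolP.
  by move=> r s t /asboolP ps /asboolP pt; apply/asboolP; rewrite pM ps pt.
- split; first exact/asboolP.
  by move=> r s t /asboolP ps /asboolP pt; apply/asboolP; rewrite pM ps pt scaler0 addr0.
- split=> [s|s /asboolP ps /asboolP]; last by rewrite ps.
  exists (p s), (s - p s); split; [exact/asboolP| |by rewrite addrC subrK].
  apply/asboolP; rewrite -[_ - _]addrC -scaleN1r pM pp scaleN1r addNr //.
- exists x1.
    by apply/asboolP; rewrite /p yx1 x1c.
  apply: contraNneq a0 => x10; rewrite -(conjK hT a) -/c -yx1.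
  by rewrite [x1]x10 (hf0r hF) conj0.
- by move=> s t /asboolP ps /asboolP pt; exact: px.
Qed.

Hypothesis R_semilocal : semilocal R.

Lemma transfer_isotropic : isotropic (transfer Tr f) -> isotropic f.
Proof.
have hF := unimodular_hermitian_form.
move=> [M [N [[M0 hM] [N0 hN] [MN MN0] nM Mf]]].
have [v [w [e [e0 ee ev vw vv]]]] := @isotropic_summand _ h _ _ h2 hT R_semilocal E act f hF
   (fun x => x \in M) (fun x => x \in N) unimodular_regular M0 hM N0 hN MN MN0 nM Mf.
have [x [y [a [aa a0 xx xy]]]] := isotropic_idempotent h2 hT R_semilocal hF
  unimodular_regular e0 ee ev vw vv.
exact: isotropic_of_idempotent aa a0 xx xy.
Qed.

End OneSpace.

Section TwoSpaces.
Variables (P P' : lmodType A^c) (f : P -> P -> A) (f' : P' -> P' -> A).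
Hypotheses (hf : unimodular_hermitian (invol Tr) f).
Hypotheses (hf' : unimodular_hermitian (invol Tr) f').

Lemma isometric_transfer : isometric f f' -> isometric (transfer Tr f) (transfer Tr f').
Proof.
move=> [phi [bphi ephi]].
pose g0 : restr P -> restr P' := phi.
have g0P : linear g0 by move=> r x y; exact: linearP.
pose g := HB.pack_for {linear restr P -> restr P'} g0 (GRing.isLinear.Build _ _ _ _ g0 g0P).
by exists g; split=> // x y; rewrite /transfer ephi.
Qed.

Hypothesis R_semilocal : semilocal R.

Lemma transfer_isometric : isometric (transfer Tr f) (transfer Tr f') -> isometric f f'.
Proof.
have hF := unimodular_hermitian_form hf; have hF' := unimodular_hermitian_form hf'.
move=> [psi [[psi' psiK psi'K] epsi]].
have hE := unimodular_regular hf; have hE' := unimodular_regular hf'.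
have [n hn] := reg_rank_lt (trf_symmetric h2 hT hF) hE.
have [|||g hg] := isometry_herm h2 hT R_semilocal hF hF' hE _ hE' _ hn (g := psi).
- by [].
- by [].
- split=> //.
  + by move=> r x y _ _; exact: linearP.
  + by move=> x y _ _; exact: epsi.
  + by move=> y _; exists (psi' y) => //; exact: psi'K.
have gP : linear (g : P -> P').
  by move=> r x y; rewrite (hisoD hg) // [g (r *: x)](hisoM hg).
pose phi := HB.pack_for {linear P -> P'} (g : P -> P') (GRing.isLinear.Build _ _ _ _ (g : P -> P') gP).
have fphi x y : f' (phi x) (phi y) = f x y by exact: (hisoE hg).
exists phi; split=> //.
(* A right inverse is two-sided here: phi preserves the forms and f separates points. *)
have /choice [k hk] : forall y, exists x, phi x = y.
  by move=> y; have [x _ gx] := hiso_surj hg (y := y) Logic.I; exists x.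
exists k => // x; apply: (herm_inj hf) => s.
by rewrite -!fphi hk.
Qed.

End TwoSpaces.
End Transfer.

(** * Quadratic etale algebras *)

Section Trace.
Variables (R : comPzRingType) (E : lmodType R).

Definition dual_bases (I : finType) (phi : I -> E -> R) (z : I -> E) :=
  (forall k r x y, phi k (r *: x + y) = r * phi k x + phi k y) /\
  (forall x, x = \sum_k phi k x *: z k).

Lemma dual_bases_sum (I J : finType) (phi : I -> E -> R) (z : I -> E) k
    (c : J -> R) (x : J -> E) : dual_bases phi z ->
  phi k (\sum_j c j *: x j) = \sum_j c j * phi k (x j).
Proof.
move=> [phiP _].
have phi0 : phi k 0 = 0.
  apply: (addrI (phi k 0)); have := phiP k 1 0 0.
  by rewrite scale1r mul1r addr0 => <-; rewrite addr0.
by elim/big_rec2: _ => // j r y _ <-; rewrite phiP.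
Qed.

Lemma dual_bases_trace (I J : finType) phi (z : I -> E) psi (w : J -> E) (u : E -> E) :
  dual_bases phi z -> dual_bases psi w ->
  (forall (K : finType) (c : K -> R) (x : K -> E),
    u (\sum_k c k *: x k) = \sum_k c k *: u (x k)) ->
  \sum_k phi k (u (z k)) = \sum_l psi l (u (w l)).
Proof.
move=> hz hw hu; have [_ zE] := hz; have [_ wE] := hw.
transitivity (\sum_k \sum_l psi l (u (z k)) * phi k (w l)).
  by apply: eq_bigr => k _; rewrite {1}(wE (u (z k))) (dual_bases_sum k _ _ hz).
rewrite exchange_big; apply: eq_bigr => l _.
rewrite {2}(zE (w l)) hu (dual_bases_sum l _ _ hw).
by apply: eq_bigr => k _; rewrite mulrC.
Qed.

Lemma presentation_dual_bases n (i : {linear E -> 'rV[R]_n})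
    (p : {linear 'rV[R]_n -> E}) : cancel i p ->
  dual_bases (fun k x => i x 0 k) (fun k => p (delta_mx 0 k)).
Proof.
move=> ip; split=> [k r x y|x]; first by rewrite linearP !mxE.
rewrite -{1}(ip x) {1}(row_sum_delta (i x)) linear_sum.
by apply: eq_bigr => k _; rewrite linearZ.
Qed.

Lemma is_traceE (I : finType) phi (z : I -> E) (u : E -> E) t :
  dual_bases phi z ->
  (forall (K : finType) (c : K -> R) (x : K -> E),
    u (\sum_k c k *: x k) = \sum_k c k *: u (x k)) ->
  is_trace u t -> t = \sum_k phi k (u (z k)).
Proof.
move=> hz hu [n [i [p [ip ->]]]].
rewrite (dual_bases_trace hz (presentation_dual_bases ip) hu).
by apply: eq_bigr => k _; rewrite mxE.
Qed.

Lemma uniform_denominator (m : {pred R}) (I : finType) (Q : I -> R -> Prop) :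
  maximal_ideal m -> (forall k s r, Q k s -> Q k (r * s)) ->
  (forall k, exists2 s, s \notin m & Q k s) ->
  exists2 s, s \notin m & forall k, Q k s.
Proof.
move=> mm Qmul ex.
have /choice [s hs] : forall k, exists s, s \notin m /\ Q k s.
  by move=> k; have [s] := ex k; exists s.
exists (\prod_k s k).
  elim/big_rec: _ => [|k x _ xm]; first by case: mm.
  by rewrite maximal_idealM // negb_or xm andbT; case: (hs k).
by move=> k; rewrite (bigD1 k) //= mulrC; apply: Qmul; case: (hs k).
Qed.

Lemma local_zero_scalar (x : R) :
  (forall m, maximal_ideal m -> exists2 s, s \notin m & s * x = 0) -> x = 0.
Proof. exact: (@local_zero R R^o). Qed.

Definition det3 (a b c d e f g h i : R) :=
  a * (e * i - f * h) - b * (d * i - f * g) + c * (d * h - e * g).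

(* The third exterior power of a module of rank 2 vanishes. *)
Lemma rank2_det3 (f1 f2 f3 : E -> R) (x y z : E) : constant_rank E 2 ->
  (forall r x y, f1 (r *: x + y) = r * f1 x + f1 y) ->
  (forall r x y, f2 (r *: x + y) = r * f2 x + f2 y) ->
  (forall r x y, f3 (r *: x + y) = r * f3 x + f3 y) ->
  det3 (f1 x) (f1 y) (f1 z) (f2 x) (f2 y) (f2 z) (f3 x) (f3 y) (f3 z) = 0.
Proof.
move=> rk h1 h2 h3; apply: local_zero_scalar => m mm.
have [e [gen _]] := rk m (maximal_prime mm).
have val (f : E -> R) (hf : forall r x y, f (r *: x + y) = r * f x + f y) s u c :
    s *: u = \sum_i c i *: e i ->
    s * f u = c ord0 * f (e ord0) + c (lift ord0 ord0) * f (e (lift ord0 ord0)).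
  have f0 : f 0 = 0.
    apply: (addrI (f 0)); have := hf 1 0 0.
    by rewrite scale1r mul1r addr0 => <-; rewrite addr0.
  move=> eu; have -> : s * f u = f (s *: u) by rewrite -[s *: u]addr0 hf f0 addr0.
  rewrite eu !big_ord_recl big_ord0 hf; congr (_ + _).
  by rewrite hf f0 addr0.
have [s sm [c xs]] := gen x; have [t tm [d yt]] := gen y; have [r rm [k zr]] := gen z.
exists (s * t * r); first by rewrite !maximal_idealM // !negb_or sm tm rm.
have -> : s * t * r * det3 (f1 x) (f1 y) (f1 z) (f2 x) (f2 y) (f2 z) (f3 x) (f3 y) (f3 z)
  = det3 (s * f1 x) (t * f1 y) (r * f1 z) (s * f2 x) (t * f2 y) (r * f2 z)
      (s * f3 x) (t * f3 y) (r * f3 z) by rewrite /det3; ring.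
rewrite (val f1 h1 _ _ _ xs) (val f1 h1 _ _ _ yt) (val f1 h1 _ _ _ zr).
rewrite (val f2 h2 _ _ _ xs) (val f2 h2 _ _ _ yt) (val f2 h2 _ _ _ zr).
rewrite (val f3 h3 _ _ _ xs) (val f3 h3 _ _ _ yt) (val f3 h3 _ _ _ zr).
by rewrite /det3; ring.
Qed.

(** At each maximal ideal the trace is computed in a local basis e. After clearing denominators, d
    is the matrix of multiplication by s, and freeness makes its diagonal entries equal to s up to a
    unit denominator t. *)
Lemma trace_id_rank (I : finType) phi (z : I -> E) n : dual_bases phi z ->
  constant_rank E n -> \sum_k phi k (z k) = n%:R.
Proof.
move=> hz rk; have [phiP zE] := hz.
apply/eqP; rewrite -subr_eq0; apply/eqP/local_zero_scalar => m mm.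
have [hm _ _] := mm.
have [e [gen free]] := rk m (maximal_prime mm).
have [s sm /choice [c hc]] : exists2 s, s \notin m &
    forall k, exists c : 'I_n -> R, s *: z k = \sum_i c i *: e i.
  apply: (uniform_denominator (Q := fun k s => exists c : 'I_n -> R,
    s *: z k = \sum_i c i *: e i) mm) => [k s r [c hc]|k]; last exact: gen.
  exists (fun i => r * c i); rewrite -scalerA hc scaler_sumr.
  by apply: eq_bigr => i _; rewrite scalerA.
pose d j i := \sum_k phi k (e j) * c k i.
have he j : \sum_i (d j i - s *+ (i == j)) *: e i = 0.
  under eq_bigr do rewrite scalerBl.
  rewrite sumrB [X in _ - X](bigD1 j) //= eqxx mulr1n [X in _ - (_ + X)]big1; last first.
    by move=> i /negbTE ->; rewrite mulr0n scale0r.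
  rewrite addr0 [X in _ - s *: X]zE scaler_sumr.
  have -> : \sum_k s *: (phi k (e j) *: z k) = \sum_i d j i *: e i.
    transitivity (\sum_k \sum_i (phi k (e j) * c k i) *: e i).
      apply: eq_bigr => k _; rewrite scalerA mulrC -scalerA hc scaler_sumr.
      by apply: eq_bigr => i _; rewrite scalerA.
    by rewrite exchange_big; apply: eq_bigr => i _; rewrite -scaler_suml.
  by rewrite subrr.
have [t tm ht] : exists2 t, t \notin m & forall i, t * (d i i - s) = 0.
  apply: (uniform_denominator (Q := fun i t => t * (d i i - s) = 0) mm) => [i t r ti|i]; first by rewrite -mulrA ti mulr0.
  have [|t tm ti] := free (fun k => d i k - s *+ (k == i)) _ i.
    by exists 1; [case: mm|rewrite he scaler0].
  by exists t; rewrite ?tm // -ti eqxx.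
exists (t * s); first by rewrite maximal_idealM // negb_or tm.
have -> : t * s * (\sum_k phi k (z k) - n%:R) = \sum_i t * (d i i - s).
  rewrite -mulr_sumr sumrB sumr_const card_ord -mulrA; congr (_ * _).
  rewrite mulrBr mulr_natr; congr (_ - _).
  rewrite mulr_sumr exchange_big; apply: eq_bigr => k _.
  have sphi : s * phi k (z k) = phi k (s *: z k).
    have := dual_bases_sum k (fun _ : 'I_1 => s) (fun=> z k) hz.
    by rewrite !big_ord1.
  rewrite sphi hc (dual_bases_sum k _ _ hz).
  by apply: eq_bigr => i _; rewrite mulrC.
by rewrite big1.
Qed.

End Trace.

Lemma tens_lift_map (R : comPzRingType) (M N M' N' : lmodType R) (V : zmodType)
    (b : M' -> N' -> V) (g : M -> M') (k : N -> N') (t : tens M N) : balanced b ->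
  tens_lift b (tens_map g k t) = \sum_(p <- repr t) b (g p.1) (k p.2).
Proof.
move=> bb; rewrite /tens_map {2}/tens_lift /feval.
rewrite (big_morph (tens_lift b) (tens_lift_add bb) (tens_lift_zero bb)).
by apply: eq_bigr => p _; rewrite tens_lift_mk.
Qed.

Lemma sum_linear5 (R : comPzRingType) (I : finType) (c1 c2 c3 c4 c5 : R)
    (x1 x2 x3 x4 x5 : I -> R) :
  \sum_i (c1 * x1 i + c2 * x2 i + c3 * x3 i + c4 * x4 i + c5 * x5 i) =
  c1 * (\sum_i x1 i) + c2 * (\sum_i x2 i) + c3 * (\sum_i x3 i)
  + c4 * (\sum_i x4 i) + c5 * (\sum_i x5 i).
Proof. by rewrite !mulr_sumr -!big_split. Qed.

(** * The trace of a quadratic étale algebra *)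

Section Etale.
Variables (R : comPzRingType) (h : R) (A : algType R) (Tr : A -> R).
Hypothesis h2 : 2%:R * h = 1.

Lemma quadratic_etale_trace : quadratic_etale A -> is_regular_trace Tr ->
  quadratic_trace Tr.
Proof.
move=> [[comA [n [i [p ip]]] [s [_ sbi smul]]] rk] hTr.
have hz := presentation_dual_bases ip.
set phi := fun (k : 'I_n) _ => _ in hz; set z := fun (k : 'I_n) => _ in hz.
have [phiP zE] := hz.
have mulsum (a : A) (K : finType) (c : K -> R) (x : K -> A) :
    a * (\sum_k c k *: x k) = \sum_k c k *: (a * x k).
  by rewrite mulr_sumr; apply: eq_bigr => k _; rewrite scalerAr.
have trE a : Tr a = \sum_k phi k (a * z k).
  exact: (is_traceE hz (mulsum a) (hTr a)).
have trP r a b : Tr (r *: a + b) = r * Tr a + Tr b.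
  rewrite !trE mulr_sumr -big_split; apply: eq_bigr => k _.
  by rewrite mulrDl -scalerAl phiP.
split=> //.
- by rewrite trE -(trace_id_rank hz rk); apply: eq_bigr => k _; rewrite mul1r.
- by move=> a b; rewrite comA.
- move=> a; exists (h * (Tr a * Tr a - Tr (a * a))).
  have comp j x : \sum_l phi j (a * z l) * phi l x = phi j (a * x).
    rewrite [in RHS](zE x) mulsum (dual_bases_sum j _ _ hz).
    by apply: eq_bigr => l _; rewrite mulrC.
  (* Coordinate j of the Cayley-Hamilton relation, doubled. It arises by contracting two of the
     three indices of a 3 by 3 minor, which vanishes in rank 2. *)
  have step j : (Tr a * Tr a - Tr (a * a)) * phi j 1 - 2%:R * Tr a * phi j a
      + 2%:R * phi j (a * a) = 0.
    pose D k l := det3 (phi k (a * z k)) (phi k (a * z l)) (phi k 1)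
      (phi l (a * z k)) (phi l (a * z l)) (phi l 1)
      (phi j (a * z k)) (phi j (a * z l)) (phi j 1).
    have D0 : \sum_k \sum_l D k l = 0.
      by rewrite big1 // => k _; rewrite big1 // => l _; exact: rank2_det3.
    have inner k : \sum_l D k l =
        (Tr a * phi j 1 - phi j a) * phi k (a * z k)
        + (- Tr a) * (phi j (a * z k) * phi k 1)
        + (- phi j 1) * phi k (a * a * z k) + 1 * (phi j (a * z k) * phi k a)
        + 1 * (phi j (a * a * z k) * phi k 1).
      transitivity ((phi k (a * z k) * phi j 1 - phi k 1 * phi j (a * z k)) *
          (\sum_l phi l (a * z l))
        + (- phi k (a * z k)) * (\sum_l phi j (a * z l) * phi l 1)
        + (- phi j 1) * (\sum_l phi k (a * z l) * phi l (a * z k))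
        + phi j (a * z k) * (\sum_l phi k (a * z l) * phi l 1)
        + phi k 1 * (\sum_l phi j (a * z l) * phi l (a * z k))).
        by rewrite -sum_linear5; apply: eq_bigr => l _; rewrite /D /det3; ring.
      by rewrite -trE !comp !mulr1 !mulrA; ring.
    rewrite -D0 (eq_bigr _ (fun k _ => inner k)) sum_linear5 -!trE !comp.
    have -> : \sum_k phi j (a * a * z k) * phi k 1 = phi j (a * a).
      rewrite -[in RHS](mulr1 (a * a)) [in RHS](zE 1) mulsum (dual_bases_sum j _ _ hz).
      by apply: eq_bigr => l _; rewrite mulrC.
    by rewrite mulr1; ring.
  have e : (Tr a * Tr a - Tr (a * a))%:A - (2%:R * Tr a) *: a + 2%:R *: (a * a) = 0.
    have comb (c1 c2 c3 : R) (x y w : A) : c1 *: x - c2 *: y + c3 *: w =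
        \sum_k (c1 * phi k x - c2 * phi k y + c3 * phi k w) *: z k.
      rewrite {1}(zE x) {1}(zE y) {1}(zE w) !scaler_sumr -sumrB -big_split.
      by apply: eq_bigr => k _; rewrite /= scalerDl scalerBl !scalerA.
    by rewrite comb big1 // => k _; rewrite step scale0r.
  transitivity (h *: (2%:R *: (a * a))); first by rewrite scalerA mulrC h2 scale1r.
  transitivity (h *: ((2%:R * Tr a) *: a - (Tr a * Tr a - Tr (a * a))%:A)).
    by congr (_ *: _); apply/eqP; rewrite -subr_eq0 -e; apply/eqP; module_ring.
  rewrite scalerBr !scalerA; congr (_ *: _ - _).
  by rewrite mulrA [h * _]mulrC h2 mul1r.
(* The separability element [s 1], a sum of q.1 (x) q.2, furnishes trace-dual families: factors move
   across it by bimodule linearity, and the sum of the products q.1 * q.2 is 1. *)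
- pose l := repr (s 1).
  exists 'I_(size l), (fun k => (tnth (in_tuple l) k).2), (fun k => (tnth (in_tuple l) k).1).
  move=> a; rewrite -(big_tnth _ _ l xpredT (fun q => Tr (q.1 * a) *: q.2)).
  have bal k : balanced (fun x y : A => phi k x *: y).
    have phiZ r x : phi k (r *: x) = r * phi k x.
      have := dual_bases_sum k (fun _ : 'I_1 => r) (fun=> x) hz.
      by rewrite !big_ord1.
    split=> [x x' y|x y y'|r x y].
    - by rewrite -[x]scale1r phiP mul1r scale1r scalerDl.
    - by rewrite scalerDr.
    - by rewrite phiZ scalerA mulrC.
  have shift k c : \sum_(q <- l) phi k (c * q.1) *: q.2 =
      \sum_(q <- l) phi k q.1 *: (q.2 * c).
    have := sbi c 1 1; rewrite !mulr1 => e1; have := sbi 1 c 1; rewrite !mul1r => e2.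
    have := congr1 (tens_lift (fun x y : A => phi k x *: y)) (etrans (esym e1) e2).
    rewrite !(tens_lift_map _ _ _ (bal k)) => e3.
    transitivity (\sum_(q <- repr (s 1)) phi k (c * q.1) *: (q.2 * 1)).
      by apply: eq_bigr => q _; rewrite mulr1.
    by rewrite e3; apply: eq_bigr => q _; rewrite mul1r.
  transitivity (a * \sum_(q <- l) q.1 * q.2).
    by have := smul 1; rewrite /tens_lift /feval -/l => ->; rewrite mulr1.
  symmetry; under eq_bigr do rewrite trE scaler_suml.
  rewrite exchange_big /= mulr_sumr.
  transitivity (\sum_k \sum_(q <- l) phi k q.1 *: (q.2 * (a * z k))).
    apply: eq_bigr => k _; rewrite -shift; apply: eq_bigr => q _.
    by rewrite -mulrA [q.1 * _]comA.
  rewrite exchange_big; apply: eq_bigr => q _ /=.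
  rewrite {2}(zE q.1) mulr_suml mulr_sumr; apply: eq_bigr => k _.
  by rewrite -scalerAl -scalerAr; congr (_ *: _); rewrite mulrA [LHS]comA mulrA.
Qed.

End Etale.

(** * Quaternion algebras *)

Section CyclicSubmodule.
Variables (R : comPzRingType) (M : lmodType R) (x : M).

Definition cyclic_pred : {pred M} := fun y => `[< exists r, y = r *: x >].

Fact cyclic_closed : submod_closed cyclic_pred.
Proof.
split; first by apply/asboolP; exists 0; rewrite scale0r.
move=> r _ _ /asboolP[s ->] /asboolP[t ->]; apply/asboolP; exists (r * s + t).
by rewrite scalerDl scalerA.
Qed.

HB.instance Definition _ := GRing.isSubmodClosed.Build R M cyclic_pred cyclic_closed.

Definition cyclic_submodule := {y : M | cyclic_pred y}.
HB.instance Definition _ := SubChoice.on cyclic_submodule.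
HB.instance Definition _ := [SubChoice_isSubLmodule of cyclic_submodule by <:].

End CyclicSubmodule.

Lemma tens_mk0 (R : comPzRingType) (M N : lmodType R) (x : M) :
  tens_mk x (0 : N) = 0.
Proof.
apply: (addrI (tens_mk x (0 : N))).
by rewrite -(balancedDr (balanced_mk M N)) !addr0.
Qed.

(** If x (x) 1 = 0, the image of R x (x) S in M (x) S is zero; flatness makes R x (x) S itself zero,
    and faithfulness then kills R x. *)
Lemma faithfully_flat_mk1 (R : comPzRingType) (S : algType R) (M : lmodType R) (x : M) :
  faithfully_flat S -> tens_mk x (1 : S) = 0 -> x = 0.
Proof.
move=> [flat faithful] x1.
have xs (s : S) : tens_mk x s = 0.
  have bb : balanced (fun (y : M) (t : S) => tens_mk y (t * s)).
    split=> [y y' t|y t t'|r y t].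
    - by rewrite (balancedDl (balanced_mk M S)).
    - by rewrite mulrDl (balancedDr (balanced_mk M S)).
    - by rewrite -scalerAl (balancedZ (balanced_mk M S)).
  have := congr1 (tens_lift (fun (y : M) (t : S) => tens_mk y (t * s))) x1.
  by rewrite tens_lift_mk // mul1r => ->; rewrite (tens_lift_zero bb).
pose N := cyclic_submodule x.
pose g : {linear N -> M} := (val : N -> M).
have g0 (t : tens N S) : tens_map g id t = 0.
  rewrite /tens_map /tens_lift /feval big1 // => -[[_ /= /asboolP[r ->]] s] _.
  by rewrite (balancedZ (balanced_mk M S)) xs.
have px : cyclic_pred x x by apply/asboolP; exists 1; rewrite scale1r.
suff : exist _ x px = 0 :> N by move/(congr1 val).
apply: (faithful N) => t.
by apply: (flat _ _ g val_inj); rewrite !g0.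
Qed.

Section Matrices.
Variables (T : comPzRingType).

Lemma mx2_cayley (X : 'M[T]_2) :
  \tr X *: X - X *m X = (X 0 0 * X 1 1 - X 0 1 * X 1 0)%:M.
Proof.
have i01 : lift ord0 ord0 = 1 :> 'I_2 by apply: val_inj.
have ord2 (i : 'I_2) : i = 0 \/ i = 1.
  by case: i => [[|[|//]] ?]; [left|right]; apply: val_inj.
apply/matrixP => i j; rewrite !mxE /mxtrace !big_ord_recl !big_ord0 i01.
by case: (ord2 i) => ->; case: (ord2 j) => ->; rewrite ?eqxx /= ?mulr1n ?mulr0n; ring.
Qed.

(** Evaluating the hypothesis on matrix units determines the sum of the A k (x) B k: it is the sum
    of all E_ij (x) E_ji, the dual frame of matrix units for the trace form. *)
Lemma mx_sandwich_trace (I : finType) n (A B : I -> 'M[T]_n) :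
  (forall X, \sum_k A k *m X *m B k = (\tr X)%:M) ->
  forall X, \sum_k \tr (B k *m X) *: A k = X.
Proof.
move=> h X; apply/matrixP => r s; rewrite summxE.
have hd u v : \sum_k A k r s * B k u v = ((s == u) && (r == v))%:R.
  have := congr1 (fun Y : 'M_n => Y r v) (h (delta_mx s u)).
  rewrite summxE !mxE; under eq_bigr => k _ do
    rewrite -(mul_delta_mx (0 : 'I_1)) mulmxA -colE -mulmxA -rowE mxE big_ord1 !mxE.
  move=> ->; rewrite /mxtrace (bigD1 s) //= !mxE eqxx /= big1 => [|k /negbTE ks].
    by rewrite addr0 andbC; case: (r == v); case: (s == u).
  by rewrite mxE ks.
transitivity (\sum_k \sum_u \sum_v X v u * (A k r s * B k u v)).
  apply: eq_bigr => k _; rewrite mxE mulr_suml; apply: eq_bigr => u _.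
  rewrite mxE mulr_suml; apply: eq_bigr => v _; ring.
rewrite exchange_big /= (bigD1 s) //= [X in _ + X]big1 ?addr0 => [|u /negbTE us].
  rewrite exchange_big /= (bigD1 r) //= [X in _ + X]big1 ?addr0 => [|v /negbTE vr].
    by rewrite -mulr_sumr hd !eqxx mulr1.
  by rewrite -mulr_sumr hd eqxx eq_sym vr mulr0.
rewrite exchange_big big1 // => v _.
by rewrite -mulr_sumr hd eq_sym us mulr0.
Qed.

End Matrices.

(** * The reduced trace by descent from 2 by 2 matrices *)

Section Split.
Variables (R : comPzRingType) (h : R) (A : algType R) (Tr : A -> R).
Hypothesis h2 : 2%:R * h = 1.
Variables (T : comPzRingType) (iota : R -> T) (alpha : A -> 'M[T]_2).
Hypotheses (iota_inj : injective iota) (iotaD : {morph iota : r s / r + s})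
  (iotaM : {morph iota : r s / r * s}) (iota1 : iota 1 = 1).
Hypotheses (alpha_inj : injective alpha) (alphaD : {morph alpha : a b / a + b})
  (alphaM : {morph alpha : a b / a * b >-> a *m b}) (alpha1 : alpha 1 = 1%:M)
  (alphaZ : forall r a, alpha (r *: a) = iota r *: alpha a).
Hypothesis alpha_span : forall X, exists l : seq (A * T),
  X = \sum_(p <- l) p.2 *: alpha p.1.
Hypothesis trE : forall a, iota (Tr a) = \tr (alpha a).
Hypothesis sandwich_surj : forall g : {linear A -> A},
  exists t : tens A A, sandwich t =1 g.

Lemma split_quadratic_trace : quadratic_trace Tr.
Proof.
have trP r a b : Tr (r *: a + b) = r * Tr a + Tr b.
  by apply: iota_inj; rewrite iotaD iotaM !trE alphaD alphaZ mxtraceD mxtraceZ.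
have tr1 : Tr 1 = 2%:R.
  by apply: iota_inj; rewrite trE alpha1 mxtrace1 mulr2n iotaD iota1.
have alpha0 : alpha 0 = 0 by apply: (addrI (alpha 0)); rewrite -alphaD !addr0.
have tr0 : Tr 0 = 0.
  have := trP 1 0 0; rewrite scale1r addr0 mul1r => e.
  by apply: (addrI (Tr 0)); rewrite -e addr0.
pose g0 c (a : A) : A := (c * Tr a)%:A.
have g0P c : linear (g0 c).
  by move=> r a b; rewrite /g0 trP; module_ring.
pose g c := HB.pack_for {linear A -> A} (g0 c) (GRing.isLinear.Build _ _ _ _ _ (g0P c)).
split=> //.
- by move=> a b; apply: iota_inj; rewrite !trE !alphaM mxtrace_mulC.
- move=> a; pose z := Tr a *: a - a * a.
  have alphaN x : alpha (- x) = - alpha x.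
    by apply/eqP; rewrite -addr_eq0 -alphaD addNr alpha0.
  have az : alpha z = (alpha a 0 0 * alpha a 1 1 - alpha a 0 1 * alpha a 1 0)%:M.
    by rewrite alphaD alphaN alphaZ alphaM trE mx2_cayley.
  have zC b : z * b = b * z.
    by apply: alpha_inj; rewrite !alphaM az scalar_mxC.
  have [t ht] := sandwich_surj (g h).
  (* h Tr is a sandwich map, so it commutes with the central element z. *)
  have zg : z * g0 h 1 = g0 h z.
    rewrite -[g0 h 1]ht -[g0 h z]ht /sandwich /tens_lift /feval mulr_sumr.
    by apply: eq_bigr => p _; rewrite mulr1 !mulrA zC.
  have zE : z = (h * Tr z)%:A.
    by rewrite -[RHS]zg /g0 tr1 mulrC h2 scale1r mulr1.
  by exists (h * Tr z); rewrite -zE /z opprB addrC subrK.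
(* An element t whose sandwich map is the reduced trace gives the frame. Its defining identity
   extends from A to all matrices by T-linearity, where [mx_sandwich_trace] applies. *)
- have [t ht] := sandwich_surj (g 1); pose l := repr t.
  exists 'I_(size l), (fun k => (tnth (in_tuple l) k).1), (fun k => (tnth (in_tuple l) k).2).
  have {}ht x : \sum_(k < size l) (tnth (in_tuple l) k).1 * x * (tnth (in_tuple l) k).2
      = (Tr x)%:A.
    have := ht x; rewrite /sandwich /tens_lift /feval -/l [g _ _]/(g0 1 x) /g0 mul1r.
    by rewrite (big_tnth _ _ l xpredT (fun q => q.1 * x * q.2)).
  have alpha_sum (I : finType) (F : I -> A) : alpha (\sum_i F i) = \sum_i alpha (F i).
    exact: (big_morph alpha alphaD alpha0).
  move=> a; apply: alpha_inj; rewrite alpha_sum.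
  pose A1 k := alpha (tnth (in_tuple l) k).1; pose B1 k := alpha (tnth (in_tuple l) k).2.
  rewrite -(@mx_sandwich_trace T _ _ A1 B1 _ (alpha a)).
    by apply: eq_bigr => k _; rewrite alphaZ trE alphaM.
  move=> X; have [s ->] := alpha_span X.
  transitivity (\sum_(p <- s) \sum_k p.2 *: (A1 k *m alpha p.1 *m B1 k)).
    rewrite exchange_big; apply: eq_bigr => k _ /=.
    rewrite mulmx_sumr mulmx_suml; apply: eq_bigr => p _.
    by rewrite -scalemxAr -scalemxAl.
  rewrite (big_morph (@mxtrace T 2) (@mxtraceD T 2) (mxtrace0 T 2)).
  rewrite (big_morph (@scalar_mx T 2) (raddfD _) (raddf0 _)).
  apply: eq_bigr => p _; rewrite -scaler_sumr.
  under eq_bigr do rewrite -!alphaM.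
  rewrite -alpha_sum ht alphaZ alpha1 trE mxtraceZ.
  by rewrite !scale_scalar_mx mulr1.
Qed.

End Split.

Lemma reduced_trace_quadratic (R : comPzRingType) (h : R) (A : algType R) (Tr : A -> R) :
  2%:R * h = 1 -> azumaya A -> is_reduced_trace 2 Tr -> quadratic_trace Tr.
Proof.
move=> h2 [_ _ _ surj] [S [alpha [comS ff [alphaA [k liftK kK]] trE]]].
pose T : comPzRingType :=
  HB.pack_for comPzRingType S (GRing.PzRing_hasCommutativeMul.Build S comS).
have alphaZ r a : alpha (r *: a) = r%:A *: alpha a.
  by rewrite -[r *: a]mulr_algl rmorphM alphaA -mulmxE mul_scalar_mx.
have bal : balanced (fun (a : A) (s : S) => s *: alpha a).
  split=> [a a' s|a s s'|r a s]; first by rewrite rmorphD scalerDr.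
    by rewrite scalerDl.
  by rewrite alphaZ scalerA mulr_algr.
have iota_inj : injective (fun r : R => r%:A : S).
  move=> r s /eqP; rewrite -subr_eq0 -scalerBl => /eqP rs.
  apply/eqP; rewrite -subr_eq0; apply/eqP.
  apply: (@faithfully_flat_mk1 R S R^o (r - s) ff).
  have -> : (r - s : R^o) = (r - s) *: (1 : R^o) by rewrite /GRing.scale /= mulr1.
  by rewrite (balancedZ (balanced_mk _ _)) rs tens_mk0.
have alpha_inj : injective alpha.
  move=> a b ab; apply/eqP; rewrite -subr_eq0; apply/eqP.
  apply: (faithfully_flat_mk1 ff); apply: (can_inj liftK).
  by rewrite tens_lift_mk // rmorphB ab subrr scaler0 (tens_lift_zero bal).
apply: (@split_quadratic_trace R h A Tr h2 T (fun r => r%:A : S) alpha) => //.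
- by move=> r s; exact: scalerDl.
- by move=> r s; rewrite -[RHS]/(r%:A * s%:A : S) mulr_algl scalerA.
- exact: scale1r.
- exact: rmorphD.
- exact: rmorphM.
- exact: rmorph1.
- by move=> X; exists (repr (k X)); rewrite -[LHS]kK.
Qed.

Theorem theorem8p5 (R : comPzRingType) (A : algType R)
  (Tr : A -> R) (sigma : A -> A)
  (P P' : lmodType A^c) (f : P -> P -> A) (f' : P' -> P' -> A)
  (R_semilocal : semilocal R)
  (R_half : exists h : R, 2%:R * h = 1)
  (A_Tr : quadratic_etale A /\ is_regular_trace Tr \/
          azumaya_of_degree A 2 /\ is_reduced_trace 2 Tr)
  (sigmaE : forall x : A, sigma x = (Tr x)%:A - x)
  (f_herm : unimodular_hermitian sigma f)
  (f'_herm : unimodular_hermitian sigma f') :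
  unimodular_hermitian (@idfun R) (transfer Tr f) /\
  (isotropic f <-> isotropic (transfer Tr f)) /\
  (isometric f f' <-> isometric (transfer Tr f) (transfer Tr f')).
Proof.
have [h h2] := R_half.
have hT : quadratic_trace Tr.
  case: A_Tr => [[etA trA]|[[azA _] trA]].
    exact: (quadratic_etale_trace h2 etA trA).
  exact: (reduced_trace_quadratic h2 azA trA).
have sE : sigma = invol Tr by apply/funext.
rewrite sE in f_herm f'_herm.
split; first exact: (transfer_unimodular h2 hT f_herm).
split; split.
- exact: (isotropic_transfer hT).
- exact: (transfer_isotropic h2 hT f_herm R_semilocal).
- exact: (isometric_transfer Tr).
- exact: (transfer_isometric h2 hT f_herm f'_herm R_semilocal).
Qed.
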